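(* There exists an absolute constant $A\ge1$ such that for all $p>2$, $a_p>0$ and $n=1,2,\ldots$, $$A^{-1}\sqrt{\min(p,n)}\;n^{\frac{p-2}{2p}}a_p\le B^{\rm Ch}_p(a_p,n)\le A\sqrt{\min(p,n)}\;n^{\frac{p-2}{2p}}a_p.$$
   Context: A real Banach space $(\mathcal X,\|\cdot\|)$ is called $(2,D)$-smooth ($D>0$) if $\|x+y\|^2+\|x-y\|^2\le 2\|x\|^2+2D^2\|y\|^2$ for all $x,y\in\mathcal X$. For a separable Banach space $\mathcal X$, $\mathcal M(\mathcal X)$ is the class of all martingales $f=(f_0,f_1,\ldots)$ of Bochner-integrable random vectors in $\mathcal X$ with $f_0\equiv0$, on some probability space with respect to some filtration (both may depend on $f$). Put $d_j=f_j-f_{j-1}$ for $j\ge1$ and $S_p=\left(\sum_{j\ge1}\|d_j\|^p\right)^{1/p}$. For a real random variable $Y$, $\|Y\|_p=(\mathbf E|Y|^p)^{1/p}$. Define $$B^{\rm Ch}_p(a_p,n)=\sup\left\{\big\|\,\|f_n\|\,\big\|_p:\ (0,f_1,\ldots,f_n,f_n,f_n,\ldots)\in\mathcal M(\mathcal X),\ D\|S_p\|_p=a_p,\ \mathcal X\text{ is a }(2,D)\text{-smooth separable Banach space}\right\},$$ where $n$ is fixed and the supremum is over all $D>0$, all such $\mathcal X$ and all such martingales. *)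

(* Defs.v *)
From HB Require Import structures.
From mathcomp Require Import all_boot all_order all_algebra.
From mathcomp Require Import all_classical all_reals all_analysis.

Set Implicit Arguments.
Unset Strict Implicit.
Unset Printing Implicit Defensive.

Import Order.TTheory GRing.Theory Num.Theory.
Import numFieldNormedType.Exports.

Local Open Scope classical_set_scope.
Local Open Scope ring_scope.

Definition separable_space (X : topologicalType) : Prop :=
  exists2 S : set X, countable S & dense S.

Definition smooth2 (R : realType) (X : normedModType R) (D : R) : Prop :=
  forall x y : X,
    `|x + y| ^+ 2 + `|x - y| ^+ 2 <= 2 * `|x| ^+ 2 + 2 * D ^+ 2 * `|y| ^+ 2.

Definition borel_sets (X : topologicalType) : set (set X) :=
  <<s [set U : set X | open U] >>.

(* The sigma-algebra G on T is an explicit argument, so that f can be measured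
   against the members of a filtration. *)
Definition borel_measurable (T : Type) (X : topologicalType)
    (G : set (set T)) (f : T -> X) : Prop :=
  forall B : set X, borel_sets B -> G (f @^-1` B).

Section bochner.
Context (R : realType) (X : completeNormedModType R).
Context (d : measure_display) (T : measurableType d) (P : probability T R).
Implicit Types (A : set T) (s f g : T -> X).

Definition simple_fun s : Prop :=
  finite_set (range s) /\ forall v : X, measurable (s @^-1` [set v]).

Definition simple_integral A s : X :=
  \sum_(v \in range s) fine (P (A `&` s @^-1` [set v])) *: v.

Definition L1_approx f (s : nat -> T -> X) : Prop :=
  (forall k, simple_fun (s k)) /\
  (\int[P]_w `|f w - s k w|%:E)%E @[k --> \oo] --> 0%E.

(* For Borel measurable f, the existence of an approximating sequence entails
   E|f| < oo and that f is almost surely separably valued, hence strongly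
   measurable. *)
Definition bochner_integrable f : Prop :=
  borel_measurable measurable f /\ exists s : nat -> T -> X, L1_approx f s.

(* When f is Bochner integrable and A is measurable, the set below is a
   singleton; 0 is a junk value for the other cases. *)
Definition bochner_integral A f : X :=
  xget 0 [set v | exists2 s : nat -> T -> X, L1_approx f s &
                    simple_integral A (s k) @[k --> \oo] --> v].

(* g is a version of E(f | G); G is meant to be a sub-sigma-algebra. *)
Definition is_cond_expectation (G : set (set T)) f g : Prop :=
  [/\ bochner_integrable g, borel_measurable G g &
      forall A, G A -> bochner_integral A g = bochner_integral A f].

Definition filtration (F : nat -> set (set T)) : Prop :=
  [/\ forall j, sigma_algebra [set: T] (F j),
      forall j, F j `<=` measurable &
      forall i j, (i <= j)%N -> F i `<=` F j].

(* Membership in the class M(X): the martingales considered start at 0. *)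
Definition martingale0 (F : nat -> set (set T)) (f : nat -> T -> X) : Prop :=
  [/\ filtration F,
      forall j, borel_measurable (F j) (f j),
      forall j, bochner_integrable (f j),
      forall j, is_cond_expectation (F j) (f j.+1) (f j) &
      forall w, f 0%N w = 0].

Definition Sp (p : R) (f : nat -> T -> X) (w : T) : \bar R :=
  ((\sum_(1 <= j <oo) (`|f j w - f j.-1 w| `^ p)%:E) `^ p^-1)%E.

End bochner.

Definition BCh (R : realType) (p a : R) (n : nat) : \bar R :=
  ereal_sup [set r : \bar R |
    exists (D : R) (X : completeNormedModType R)
           (d : measure_display) (T : measurableType d) (P : probability T R)
           (F : nat -> set (set T)) (f : nat -> T -> X),
      [/\ [/\ 0 < D, separable_space X & smooth2 X D],
          martingale0 P F f,
          forall k, (n <= k)%N -> f k = f n,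
          (D%:E * 'N[P]_p%:E [Sp p f] = a%:E)%E &
          r = ('N[P]_p%:E [(fun w => `|f n w|%:E)])%E]].

(* Main.v *)
From HB Require Import structures.
Require Import Defs.
From mathcomp Require Import all_boot all_order all_algebra finmap.
From mathcomp Require Import all_classical all_reals all_analysis.
From mathcomp Require Import measurable_realfun ring lra zify.

Set Implicit Arguments.
Unset Strict Implicit.
Unset Printing Implicit Defensive.

Import Order.TTheory GRing.Theory Num.Theory.
Import numFieldNormedType.Exports.

Local Open Scope classical_set_scope.
Local Open Scope ring_scope.

(** Upper bound.  Write x = f_j and y = f_(j+1) - f_j.  Two facts reduce the
    bound to inequalities between real numbers.

    - The space L^p(X) inherits smoothness from X, with constant of order
      D sqrt p.  Put |x + y| = m + h and |x - y| = m - h.  Then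
      |h| <= |y|, and smoothness says m^2 + h^2 <= |x|^2 + D^2 |y|^2, so the
      two-point inequality [two_point_powR] for real numbers yields
      [smooth2_powR]: half of |x + y|^p + |x - y|^p is at most
      (|x|^2 + 25 p D^2 |y|^2)^(p/2).  Minkowski's inequality in L^(p/2)
      integrates this.

    - The conditional expectation of 2 f_j - f_(j+1) given F_j is f_j, so that
      E|f_j|^p <= E|x - y|^p: this is the conditional Jensen inequality
      [norm_powR_contract].

    Together, with N_j the L^p norm of f_j and d_j = f_j - f_(j-1),
    N_(j+1)^2 <= N_j^2 + 50 p D^2 |d_(j+1)|_p^2 ([smooth_moment_step]).  Summing
    over j and comparing the sum of the squares |d_j|_p^2 with the sum of the
    E|d_j|^p by a power mean gives sqrt(50 p) n^((p-2)/(2p)) a, which is the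
    claim when p <= n.  When n <= p, the triangle inequality alone gives
    n^(1-1/p) a / D, and D >= 1 as soon as X is not trivial.

    Lower bound.  On the real line, which is (2,1)-smooth, take c times a simple
    random walk of n steps.  Here S_p is the constant c n^(1/p), so only
    the L^p norm of the walk matters.  Its 2k-th moment satisfies a recursion
    ([walk_moment_rec]) that makes it at least binom(n,k) (2k)!/2^k, hence at
    least (n k / 4)^k when 2k <= n.  Choosing k of the order of min(p,n) with
    2k <= p, Jensen's inequality bounds the L^p norm of the walk below by a
    constant multiple of sqrt(min(p,n) n).  The constant A = 8 serves both
    bounds. *)

(** * Inequalities for real powers *)

Section real_inequalities.
Context {R : realType}.
Implicit Types (p q s t x y h m : R).

(** Convexity of the power function in tangent form. It is a rewriting of Young's
    inequality for y and s^(p-1), and every Jensen-type bound below comes from it. *)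
Lemma powR_tangent p s y : 1 < p -> 0 <= s -> 0 <= y ->
  s `^ p + p * s `^ (p - 1) * (y - s) <= y `^ p.
Proof.
move=> p1 s0 y0.
have p0 : 0 < p by apply: lt_trans p1.
have p10 : 0 < p - 1 by rewrite subr_gt0.
have := @conjugate_powR R y (s `^ (p - 1)) p (p / (p - 1)) y0 (powR_ge0 _ _) p0.
rewrite divr_gt0// => /(_ isT).
have -> : p^-1 + (p / (p - 1))^-1 = 1 by field; lra.
move=> /(_ erefl).
rewrite -powRrM mulrCA divff ?lt0r_neq0// mulr1 invf_div => young.
have es : s * s `^ (p - 1) = s `^ p by rewrite mulr_powRB1.
rewrite -(ler_pM2l p0) in young.
have e : p * (y `^ p / p + s `^ p * ((p - 1) / p)) =
  y `^ p + (p - 1) * s `^ p by field; lra.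
rewrite e -es in young; rewrite -es; lra.
Qed.

(** Sum the tangent inequalities at the mean of the x_i: their linear terms cancel. *)
Lemma powR_mean n (x : nat -> R) p : 1 < p -> (0 < n)%N ->
  (forall i, 0 <= x i) ->
  (\sum_(i < n) x i) `^ p <= n%:R `^ (p - 1) * \sum_(i < n) x i `^ p.
Proof.
move=> p1 n0 x0.
have p0 : 0 < p by apply: lt_trans p1.
have n0' : 0 < n%:R :> R by rewrite ltr0n.
set S := \sum_(i < n) x i.
have S0 : 0 <= S by rewrite sumr_ge0.
have Sn0 : 0 <= S / n%:R by rewrite divr_ge0// ltW.
have : \sum_(i < n) ((S / n%:R) `^ p +
    p * (S / n%:R) `^ (p - 1) * (x i - S / n%:R)) <= \sum_(i < n) x i `^ p.
  by apply: ler_sum => i _; apply: powR_tangent.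
rewrite big_split /= -mulr_sumr sumrB !sumr_const card_ord -/S.
rewrite -[X in S - X]mulr_natr divfK ?lt0r_neq0// subrr mulr0 addr0.
rewrite -[_ `^ p *+ n]mulr_natr => le.
have -> : S `^ p = n%:R `^ (p - 1) * ((S / n%:R) `^ p * n%:R).
  rewrite mulrCA (mulrC (_ `^ (p - 1))) mulr_powRB1 ?(ltW n0')//.
  by rewrite -powRM ?(ltW n0')// divfK ?lt0r_neq0.
by rewrite ler_wpM2l// powR_ge0.
Qed.

Lemma powR_mean2 x y p : 1 < p -> 0 <= x -> 0 <= y ->
  2 * ((x + y) / 2) `^ p <= x `^ p + y `^ p.
Proof.
move=> p1 x0 y0; have s0 : 0 <= (x + y) / 2 by lra.
have hx := powR_tangent p1 s0 x0; have hy := powR_tangent p1 s0 y0.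
nra.
Qed.

(** For x^2 <= 1/2 the bounds e^x <= 1/(1-x) and e^(-x) <= 1/(1+x) add up to
    2/(1-x^2) <= 2(1 + 2x^2); for larger x already e^x <= e^(2x^2). The sharp
    exponent is x^2/2, but any multiple of x^2 gives the same rate. *)
Lemma cosh_le_expR2 x : expR x + expR (- x) <= 2 * expR (2 * x ^+ 2).
Proof.
wlog x0 : x / 0 <= x => [H|].
  have [|x0] := leP 0 x; first exact: H.
  by rewrite addrC -{2}(opprK x) -(sqrrN x) H// oppr_ge0 ltW.
have [x12|x12] := leP (x ^+ 2) (1 / 2); last first.
  have x1 : 1 / 2 <= x by nra.
  have h1 : expR x <= expR (2 * x ^+ 2) by rewrite ler_expR; nra.
  have h2 : expR (- x) <= expR (2 * x ^+ 2) by rewrite ler_expR; nra.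
  lra.
have x1 : x < 1 by nra.
have i1 y : y < 1 -> expR y <= (1 - y)^-1.
  move=> y1; rewrite -[y]opprK expRN lef_pV2 ?posrE ?expR_gt0 ?opprK ?subr_gt0//.
  exact: expR_ge1Dx.
have h1 := i1 _ x1.
have h2 : expR (- x) <= (1 + x)^-1 by rewrite -{2}(opprK x); apply: i1; lra.
apply: (@le_trans _ _ (2 * (1 + 2 * x ^+ 2))); last first.
  by rewrite ler_wpM2l// expR_ge1Dx.
apply: (le_trans (lerD h1 h2)).
have -> : (1 - x)^-1 + (1 + x)^-1 = 2 / (1 - x ^+ 2) by field; nra.
rewrite ler_pdivrMr; last by nra.
nra.
Qed.

(** Two regimes, separated by the size of p t^2. If p t^2 >= 1/8 then
    (1+t)^2 <= 4 <= 1 + 24 p t^2. If p t^2 < 1/8, the left side is at most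
    2 cosh(pt) <= 2 exp(2 p^2 t^2), where exp(4 p t^2) <= 1/(1 - 4 p t^2) is at most
    1 + 24 p t^2. *)
Lemma two_point_powR1 p t : 2 <= p -> 0 <= t <= 1 ->
  (1 + t) `^ p + (1 - t) `^ p <= 2 * (1 + 24 * p * t ^+ 2) `^ (p / 2).
Proof.
move=> p2 /andP[t0 t1].
have p0 : 0 <= p by lra.
have ph0 : 0 <= p / 2 by lra.
have sq x : 0 <= x -> x `^ p = (x ^+ 2) `^ (p / 2).
  by move=> x0; rewrite -powR_mulrn// -powRrM; congr (_ `^ _); field.
have [w8|w8] := leP (1 / 8) (p * t ^+ 2).
  suff H x : 0 <= x <= 1 + t -> x `^ p <= (1 + 24 * p * t ^+ 2) `^ (p / 2).
    have h1 : (1 + t) `^ p <= (1 + 24 * p * t ^+ 2) `^ (p / 2).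
      by apply: H; rewrite lexx andbT; lra.
    have h2 : (1 - t) `^ p <= (1 + 24 * p * t ^+ 2) `^ (p / 2).
      by apply: H; apply/andP; split; lra.
    lra.
  move=> /andP[x0 xt]; rewrite sq//.
  by rewrite ge0_ler_powR// ?nnegrE; nra.
have e1 : (1 + t) `^ p <= expR (t * p).
  by rewrite expRM ge0_ler_powR// ?nnegrE ?expR_ge0 ?expR_ge1Dx; lra.
have e2 : (1 - t) `^ p <= expR (- (t * p)).
  by rewrite -mulNr expRM ge0_ler_powR// ?nnegrE ?expR_ge0 ?expR_ge1Dx; lra.
apply: (le_trans (lerD e1 e2)); apply: (le_trans (cosh_le_expR2 _)).
rewrite ler_wpM2l//.
have -> : 2 * (t * p) ^+ 2 = 4 * p * t ^+ 2 * (p / 2) by field.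
rewrite expRM ge0_ler_powR// ?nnegrE ?expR_ge0//; first by nra.
rewrite -[X in expR X]opprK expRN.
apply: (@le_trans _ _ (1 - 4 * p * t ^+ 2)^-1).
  rewrite lef_pV2 ?posrE ?expR_gt0//; last by nra.
  exact: expR_ge1Dx.
rewrite -[_^-1]mul1r ler_pdivrMr; last by nra.
have w0 : 0 <= p * t ^+ 2 by rewrite mulr_ge0// sqr_ge0.
have w1 : 0 <= 20 - 96 * (p * t ^+ 2) by lra.
have := mulr_ge0 w0 w1; lra.
Qed.

(** By homogeneity from the case m = 1. The factor of h^2 grows linearly in p, and its
    square root is the order sqrt p of the final bound. *)
Lemma two_point_powR p m h : 2 <= p -> 0 <= h <= m ->
  (m + h) `^ p + (m - h) `^ p <= 2 * (m ^+ 2 + 24 * p * h ^+ 2) `^ (p / 2).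
Proof.
move=> p2 /andP[h0 hm].
have p0 : p != 0 by rewrite gt_eqF//; lra.
have [m0|m0] := eqVneq m 0.
  have -> : h = 0 by apply/eqP; rewrite eq_le h0 -m0 hm.
  by rewrite m0 addr0 subrr powR0// addr0 mulr_ge0// powR_ge0.
have mp : 0 < m by rewrite lt_neqAle eq_sym m0 (le_trans h0).
have t01 : 0 <= h / m <= 1.
  by rewrite divr_ge0 ?(ltW mp)// ler_pdivrMr// mul1r.
have := two_point_powR1 p2 t01.
have -> : m + h = m * (1 + h / m) by field.
have -> : m - h = m * (1 - h / m) by field.
have -> : m ^+ 2 + 24 * p * h ^+ 2 = m ^+ 2 * (1 + 24 * p * (h / m) ^+ 2).
  by field.
case/andP: t01 => t0 t1.
have g0 : 0 <= 1 + 24 * p * (h / m) ^+ 2.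
  by rewrite addr_ge0// mulr_ge0 ?sqr_ge0//; lra.
rewrite (@powRM _ (m ^+ 2)) ?sqr_ge0// (@powRM _ m (1 + _)) ?(ltW mp)//; last lra.
rewrite (@powRM _ m (1 - _)) ?(ltW mp)//; last lra.
have -> : (m ^+ 2) `^ (p / 2) = m `^ p.
  by rewrite -powR_mulrn ?(ltW mp)// -powRrM; congr (_ `^ _); field.
rewrite -mulrDr (mulrCA 2) => le.
by rewrite ler_wpM2l// powR_ge0.
Qed.

End real_inequalities.

(** * The parallelogram inequality with exponent p *)

Section smooth_spaces.
Context {R : realType} (X : normedModType R).

Lemma smooth2_ge1 (D : R) (y : X) : smooth2 X D -> 0 < D -> y != 0 -> 1 <= D.
Proof.
move=> sm D0 y0; have := sm 0 y.
rewrite add0r sub0r normrN normr0 expr0n /= => le.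
have y2 : 0 < `|y| ^+ 2 by rewrite exprn_gt0// normr_gt0.
have D2 : 1 <= D ^+ 2 by rewrite -(ler_pM2r y2); lra.
by rewrite leNgt; apply/negP => D1; nra.
Qed.

(** Only m = (|x+y| + |x-y|)/2 and h = (|x+y| - |x-y|)/2 enter. The hypothesis
    bounds m^2 + h^2 and the triangle inequality bounds h by |y|; the latter pays for
    the term 24 p h^2 of the two-point inequality, and D >= 1 merges the two. *)
Lemma smooth2_powR (D p : R) (x y : X) : smooth2 X D -> 1 <= D -> 2 <= p ->
  `|x + y| `^ p + `|x - y| `^ p <=
    2 * (`|x| ^+ 2 + 25 * p * D ^+ 2 * `|y| ^+ 2) `^ (p / 2).
Proof.
move=> sm D1 p2.
wlog ab : y / `|x - y| <= `|x + y| => [H|].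
  have [|/ltW ab] := leP (`|x - y|) (`|x + y|); first exact: H.
  by have := H (- y); rewrite opprK normrN => /(_ ab); rewrite [leLHS]addrC.
set a := `|x + y| in ab *; set b := `|x - y| in ab *.
have a0 : 0 <= a := normr_ge0 _; have b0 : 0 <= b := normr_ge0 _.
have aby : a <= b + 2 * `|y|.
  rewrite /a; have -> : x + y = (x - y) + (y + y) by rewrite addrA subrK.
  by rewrite (le_trans (ler_normD _ _))// lerD2l mulr_natl mulr2n ler_normD.
have hm : 0 <= (a - b) / 2 <= (a + b) / 2 by apply/andP; split; lra.
have := two_point_powR p2 hm.
have -> : (a + b) / 2 + (a - b) / 2 = a by field.
have -> : (a + b) / 2 - (a - b) / 2 = b by field.
move=> /le_trans; apply; rewrite ler_wpM2l//.
have y0 : 0 <= `|y| by [].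
have h2 : ((a - b) / 2) ^+ 2 <= `|y| ^+ 2.
  by rewrite ler_pXn2r ?nnegrE//; lra.
have s := sm x y; rewrite -/a -/b in s.
have D2 : 1 <= D ^+ 2 by rewrite -[1](expr1n _ 2) ler_pXn2r// nnegrE; lra.
have yD : 0 <= (D ^+ 2 - 1) * `|y| ^+ 2 by rewrite mulr_ge0 ?sqr_ge0 ?subr_ge0.
have e1 : ((a + b) / 2) ^+ 2 = (a ^+ 2 + b ^+ 2) / 2 - ((a - b) / 2) ^+ 2.
  by field.
have k1 : (24 * p - 1) * ((a - b) / 2) ^+ 2 <= (24 * p - 1) * `|y| ^+ 2.
  by rewrite ler_wpM2l//; lra.
have k2 : 0 <= 25 * p - 1 by lra.
have k3 := mulr_ge0 k2 yD.
have ph0 : 0 <= p * ((a - b) / 2) ^+ 2 by rewrite mulr_ge0 ?sqr_ge0//; lra.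
have py0 : 0 <= p * `|y| ^+ 2 by rewrite mulr_ge0 ?sqr_ge0//; lra.
have py1 : 0 <= p * D ^+ 2 * `|y| ^+ 2.
  by rewrite !mulr_ge0 ?sqr_ge0//; lra.
have sq1 := sqr_ge0 ((a + b) / 2).
have sq2 := sqr_ge0 (`|x|).
rewrite ge0_ler_powR// ?nnegrE; [lra|lra|lra|].
rewrite e1; lra.
Qed.

End smooth_spaces.

(** * Borel functions with values in a separable space *)

Section separable_spaces.
Context {R : realType} (X : normedModType R).

Lemma separable_dense_seq : separable_space X ->
  exists s : nat -> X, forall x e, 0 < e -> exists n, `|x - s n| < e.
Proof.
move=> [S /countable_injP[f finj] dS].
exists (fun n => xget 0 [set x | S x /\ f x = n]) => x e e0.
have [y [bxy Sy]] := dS (ball x e) (ex_intro _ _ (ballxx x e0)) (ball_open x e).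
exists (f y); case: xgetP => [z _ [Sz fz]|/(_ y)]; last by case.
have -> : z = y by apply: finj => //; exact: mem_set.
by move: bxy; rewrite -ball_normE.
Qed.

End separable_spaces.

Section borel_functions.
Context {R : realType} {X : normedModType R}.
Context {d : measure_display} {T : measurableType d}.
Implicit Types f g : T -> X.

Lemma borel_preimage_open (G : set (set T)) f (U : set X) :
  borel_measurable G f -> open U -> G (f @^-1` U).
Proof. by move=> mf oU; apply: mf; exact: sub_sigma_algebra. Qed.

Lemma measurable_normB_cst f (x : X) :
  borel_measurable measurable f -> measurable_fun setT (fun w => `|f w - x|).
Proof.
move=> mf mD; apply: (measurability _ (RGenInftyO.measurableE R)) => //.
move=> _ [_ [r ->] <-]; rewrite setTI.
have -> : (fun w => `|f w - x|) @^-1` `]-oo, r[%classic = f @^-1` ball x r.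
  by apply/seteqP; split => w /=; rewrite in_itv/= -ball_normE /ball_ /= distrC.
exact: borel_preimage_open mf (ball_open _ _).
Qed.

Lemma measurable_norm f :
  borel_measurable measurable f -> measurable_fun setT (fun w => `|f w|).
Proof.
move=> /(measurable_normB_cst 0); apply: eq_measurable_fun => w _.
by rewrite subr0.
Qed.

(** Borel measurability of a difference fails in general, since the Borel
    sets of X * X may form more than the product sigma-algebra. Separability saves it:
    |f - g| < r iff |f - s| + |g - s| < r for some s in a countable dense set. *)
Lemma measurable_normB f g : separable_space X ->
  borel_measurable measurable f -> borel_measurable measurable g ->
  measurable_fun setT (fun w => `|f w - g w|).
Proof.
move=> /separable_dense_seq[s sP] mf mg mD.
apply: (measurability _ (RGenInftyO.measurableE R)) => //.
move=> _ [_ [r ->] <-]; rewrite setTI.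
have -> : (fun w => `|f w - g w|) @^-1` `]-oo, r[%classic =
    \bigcup_n ((fun w => `|f w - s n| + `|g w - s n|) @^-1` `]-oo, r[%classic).
  apply/seteqP; split => w /=; rewrite in_itv/=.
    move=> fgr; have e0 : 0 < (r - `|f w - g w|) / 2 by lra.
    have [n fn] := sP (f w) _ e0; exists n => //=; rewrite in_itv/=.
    have : `|g w - s n| <= `|f w - g w| + `|f w - s n|.
      by rewrite (distrC (f w) (g w)) (le_trans _ (ler_normD _ _))// addrA subrK.
    lra.
  move=> [n _]/=; rewrite in_itv/=; apply: le_lt_trans.
  by rewrite (distrC (g w)) (le_trans _ (ler_normD _ _))// addrA subrK.
apply: bigcupT_measurable => n; rewrite -[X in measurable X]setTI.
by apply: measurable_funD => //; exact: measurable_normB_cst.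
Qed.

Lemma borel_measurableZ f (c : R) :
  borel_measurable measurable f -> borel_measurable measurable (fun w => c *: f w).
Proof.
move=> mf; suff H : borel_sets (X := X) `<=` [set B | measurable ((fun w => c *: f w) @^-1` B)] by [].
apply: smallest_sub.
  split => [|A /= mA|A /= mA].
  - by rewrite /= preimage_set0.
  - by rewrite setTD preimage_setC; exact: measurableC.
  - by rewrite preimage_bigcup; exact: bigcupT_measurable.
move=> U /= oU.
apply: (@borel_preimage_open measurable f ( *:%R c @^-1` U)) => //.
by move/continuousP: (@scaler_continuous _ X c); exact.
Qed.

End borel_functions.

(** * Finitely valued functions and their integrals *)

Section simple_functions.
Context {R : realType} {d : measure_display} {T : measurableType d}.
Context (P : probability T R).

(** Simple functions with an arbitrary codomain, so that several simple functions
    can be treated as one with values in a product. *)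
Definition finitely_valued (Y : Type) (q : T -> Y) : Prop :=
  finite_set (range q) /\ forall y, measurable (q @^-1` [set y]).

Lemma finitely_valued_preimage (Y : choiceType) (q : T -> Y) (B : set Y) :
  finitely_valued q -> measurable (q @^-1` B).
Proof.
move=> [fq mq].
have -> : q @^-1` B = \bigcup_(y in range q `&` B) (q @^-1` [set y]).
  apply/seteqP; split => w /= => [Bw|[y [_ By] /= ->]//].
  by exists (q w) => //; split => //; exists w.
apply: fin_bigcup_measurable => [|y _]; last exact: mq.
exact: finite_setIl.
Qed.

Lemma finitely_valued_comp (Y Z : choiceType) (q : T -> Y) (phi : Y -> Z) :
  finitely_valued q -> finitely_valued (fun w => phi (q w)).
Proof.
move=> fq; split=> [|z]; last exact: finitely_valued_preimage (phi @^-1` [set z]) fq.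
have -> : range (fun w => phi (q w)) = phi @` range q by rewrite image_comp.
exact: finite_image fq.1.
Qed.

Lemma finitely_valued_pair (Y Z : choiceType) (q : T -> Y) (r : T -> Z) :
  finitely_valued q -> finitely_valued r ->
  finitely_valued (fun w => (q w, r w)).
Proof.
move=> [fq mq] [fr mr]; split=> [|[y z]].
  apply: (@sub_finite_set _ _ (range q `*` range r)); last exact: finite_setX.
  by move=> _ [w _ <-]; split; exists w.
rewrite (_ : _ @^-1` _ = q @^-1` [set y] `&` r @^-1` [set z]).
  exact: measurableI.
by apply/seteqP; split => w /= [-> ->].
Qed.

(** Finite additivity over the fibres of q. *)
Lemma finitely_valued_measure (Y : choiceType) (q : T -> Y) (A : set T)
    (B : pred Y) : measurable A -> finitely_valued q ->
  (P (A `&` q @^-1` [set y | B y]) =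
    \sum_(y <- fset_set (range q) | B y) P (A `&` q @^-1` [set y]))%E.
Proof.
move=> mA fq; rewrite big_mkcond/=.
under eq_bigr => y _.
  rewrite (_ : (if _ then _ else _) =
      P (A `&` q @^-1` ([set y] `&` [set y | B y]))); last first.
    case: ifPn => By.
      by congr (P (_ `&` _)); apply/seteqP; split => w /=; [move=> ->|case].
    rewrite (_ : A `&` _ = set0) ?measure0//.
    by rewrite -subset0 => w /= [_ [-> By']]; rewrite By' in By.
  over.
rewrite -measure_fbigsetU; first last.
- by move=> y z _ _ [w [[_ [<- _]] [_ [<- _]]]].
- by move=> y _; apply: measurableI => //; exact: finitely_valued_preimage.
congr (P _); rewrite bigsetU_fset_set; last exact: fq.1.
apply/seteqP; split => w /=.
  by move=> [Aw Bw]; exists (q w); [exists w|].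
by move=> [y _ [Aw [-> By]]].
Qed.

Lemma ge0_integral_finitely_valued (Y : choiceType) (q : T -> Y) (A : set T)
    (h : Y -> R) : measurable A -> finitely_valued q -> (forall y, 0 <= h y) ->
  (\int[P]_(w in A) (h (q w))%:E)%E =
    (\sum_(y <- fset_set (range q)) fine (P (A `&` q @^-1` [set y])) * h y)%:E.
Proof.
move=> mA fq h0.
have eA : A = \big[setU/set0]_(y <- fset_set (range q)) (A `&` q @^-1` [set y]).
  rewrite bigsetU_fset_set; last exact: fq.1.
  apply/seteqP; split => w /= => [Aw|[y _ []]//].
  by exists (q w) => //; exists w.
have mq y : measurable (A `&` q @^-1` [set y]).
  by apply: measurableI => //; exact: fq.2.
have mh : measurable_fun setT (fun w => (h (q w))%:E).
  move=> _ B mB; rewrite setTI.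
  exact: (finitely_valued_preimage ((fun y => (h y)%:E) @^-1` B) fq).
rewrite {1}eA ge0_integral_bigsetU//=.
- rewrite -sumEFin; apply: eq_bigr => y _.
  rewrite (@eq_integral _ _ _ _ _ (cst (h y)%:E)); last first.
    by move=> w; rewrite inE => -[_ /= ->].
  rewrite integral_cst// muleC EFinM fineK//.
  by rewrite ge0_fin_numE ?measure_ge0// (le_lt_trans (probability_le1 P _))// ltry.
- by move=> y z _ _ [w [[_ <-] [_ <-]]].
- by apply: measurable_funTS.
- by move=> w _; rewrite lee_fin.
Qed.

End simple_functions.

Section simple_integrals.
Context {R : realType} {X : completeNormedModType R}.
Context {d : measure_display} {T : measurableType d} (P : probability T R).
Implicit Types (s t : T -> X) (A : set T).

(** The integral of phi o q can be computed on the fibres of q, which are finer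
    than its own. Algebra on simple integrals then reduces to taking q to be the pair
    of the functions involved. *)
Lemma simple_integral_comp (Y : choiceType) (q : T -> Y) (phi : Y -> X) A :
  measurable A -> finitely_valued q ->
  simple_integral P A (fun w => phi (q w)) =
    \sum_(y <- fset_set (range q)) fine (P (A `&` q @^-1` [set y])) *: phi y.
Proof.
move=> mA fq; rewrite /simple_integral fsbig_finite/=; last first.
  by have [] := finitely_valued_comp phi fq.
have Pfin y : P (A `&` q @^-1` [set y]) \is a fin_num.
  by rewrite fin_num_measure//; apply: measurableI => //; exact: fq.2.
have step v : fine (P (A `&` (fun w => phi (q w)) @^-1` [set v])) *: v =
    \sum_(y <- fset_set (range q) | phi y == v)
       fine (P (A `&` q @^-1` [set y])) *: phi y.
  have -> : (fun w => phi (q w)) @^-1` [set v] = q @^-1` [set y | phi y == v].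
    by apply/seteqP; split => w /= /eqP.
  rewrite finitely_valued_measure// -sum_fine//.
  by rewrite scaler_suml; apply: eq_bigr => y /eqP ->.
under eq_bigr do rewrite step.
rewrite (exchange_big_dep xpredT)//=; apply: eq_big_seq => y yq.
rewrite -big_filter (_ : [seq _ <- _ | _] = [:: phi y]) ?big_seq1//.
rewrite -(@filter_pred1_uniq _ (fset_set (range (phi \o q))) (phi y)) ?fset_uniq//.
  by apply: eq_filter => v; rewrite /= eq_sym.
have := finitely_valued_comp phi fq; move=> [fpq _].
move: yq; rewrite !in_fset_set//; last exact: fq.1.
by rewrite !inE => -[w _ <-]; exists w.
Qed.

Lemma norm_simple_integral_le (Y : choiceType) (q : T -> Y) (phi : Y -> X) A :
  measurable A -> finitely_valued q ->
  (`|simple_integral P A (fun w => phi (q w))|%:E <=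
    \int[P]_(w in A) `|phi (q w)|%:E)%E.
Proof.
move=> mA fq; rewrite simple_integral_comp//.
rewrite (@ge0_integral_finitely_valued _ _ _ P _ q A (fun y => `|phi y|))//.
rewrite lee_fin (le_trans (ler_norm_sum _ _ _))//; apply: ler_sum => y _.
by rewrite normrZ ger0_norm// fine_ge0.
Qed.

Lemma simple_integralB A s t : measurable A ->
  simple_fun s -> simple_fun t ->
  simple_integral P A s - simple_integral P A t =
  simple_integral P A (fun w => s w - t w).
Proof.
move=> mA fs ft; have fq := finitely_valued_pair fs ft.
rewrite (@simple_integral_comp _ (fun w => (s w, t w)) fst)//.
rewrite (@simple_integral_comp _ (fun w => (s w, t w)) snd)//.
rewrite (@simple_integral_comp _ (fun w => (s w, t w)) (fun y => y.1 - y.2))//.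
by rewrite -sumrB; apply: eq_bigr => y _; rewrite scalerBr.
Qed.

End simple_integrals.

(** * Bochner integrals as limits of simple integrals *)

Section bochner_integrals.
Context {R : realType} {X : completeNormedModType R}.
Context {d : measure_display} {T : measurableType d} (P : probability T R).
Context (sepX : separable_space X).
Implicit Types (f g : T -> X) (s t : nat -> T -> X) (A : set T).

Lemma finitely_valued_borel (r : T -> X) :
  finitely_valued r -> borel_measurable measurable r.
Proof. by move=> fr B _; exact: finitely_valued_preimage. Qed.

Lemma L1_approx_near f s (e : R) : L1_approx P f s -> 0 < e ->
  \forall k \near \oo, (\int[P]_w `|f w - s k w|%:E < e%:E)%E.
Proof.
move=> [_ /fine_cvgP[fin /cvgrPdist_lt h]] e0; near=> k.
have : `|0 - fine (\int[P]_w `|f w - s k w|%:E)%E| < e by near: k; exact: h.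
rewrite sub0r normrN ger0_norm ?fine_ge0 ?integral_ge0// -lte_fin fineK//.
by near: k.
Unshelve. all: by end_near. Qed.

(** The integrals of two approximations of f differ by at most their L^1 distance.
    This gives at once convergence of the approximating integrals and independence of
    the approximation. *)
Lemma simple_integral_dist f (r q : T -> X) A : measurable A ->
  borel_measurable measurable f -> simple_fun r -> simple_fun q ->
  (`|simple_integral P A r - simple_integral P A q|%:E <=
    \int[P]_w `|f w - r w|%:E + \int[P]_w `|f w - q w|%:E)%E.
Proof.
move=> mA mf fr fq; rewrite simple_integralB//.
have frq := finitely_valued_pair fr fq.
have mr : measurable_fun setT (fun w => (`|f w - r w|%:E)%E).
  by apply/measurable_EFinP/measurable_normB => //; exact: finitely_valued_borel.
have mq : measurable_fun setT (fun w => (`|f w - q w|%:E)%E).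
  by apply/measurable_EFinP/measurable_normB => //; exact: finitely_valued_borel.
apply: le_trans (norm_simple_integral_le P (fun y : X * X => y.1 - y.2) mA frq) _.
rewrite -ge0_integralD//=.
have mrq : measurable_fun setT (fun w => (`|r w - q w|%:E)%E).
  by apply/measurable_EFinP/measurable_normB => //; exact: finitely_valued_borel.
apply: (@le_trans _ _ (\int[P]_w `|r w - q w|%:E)%E).
  by apply: ge0_subset_integral.
apply: ge0_le_integral => //; first exact: emeasurable_funD.
move=> w _; rewrite -EFinD lee_fin (distrC (f w)).
by rewrite (le_trans _ (ler_normD _ _))// addrA subrK.
Qed.

Lemma simple_integral_close f s t A (e : R) : measurable A ->
  borel_measurable measurable f -> L1_approx P f s -> L1_approx P f t ->
  0 < e -> exists N : nat, forall k l, (N <= k)%N -> (N <= l)%N ->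
    `|simple_integral P A (s k) - simple_integral P A (t l)| < e.
Proof.
move=> mA mf fs ft e0.
have e20 : 0 < e / 2 by rewrite divr_gt0.
have [N1 _ h1] := L1_approx_near fs e20.
have [N2 _ h2] := L1_approx_near ft e20.
exists (maxn N1 N2) => k l; rewrite !geq_max => /andP[k1 _] /andP[_ l2].
rewrite -lte_fin; apply: le_lt_trans (simple_integral_dist mA mf _ _) _.
- exact: fs.1.
- exact: ft.1.
by rewrite [e]splitr EFinD lteD//; [exact: h1|exact: h2].
Qed.

Lemma simple_integral_cvg f s A : measurable A ->
  borel_measurable measurable f -> L1_approx P f s ->
  cvgn (fun k => simple_integral P A (s k)).
Proof.
move=> mA mf fs; apply: cauchy_cvg; apply: cauchy_exP => e e0.
have [N hN] := simple_integral_close mA mf fs fs e0.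
exists (simple_integral P A (s N)); exists N => // k /= Nk.
by rewrite -ball_normE; exact: hN.
Qed.

(** Any approximating sequence may be used to compute the integral, although the
    definition selects one value by choice. *)
Lemma bochner_integral_cvg f s A : measurable A ->
  borel_measurable measurable f -> L1_approx P f s ->
  simple_integral P A (s k) @[k --> \oo] --> bochner_integral P A f.
Proof.
move=> mA mf fs; rewrite /bochner_integral.
case: xgetP => [v _ [t ft tv]|/(_ (limn (fun k => simple_integral P A (s k))))].
  apply/cvgrPdist_lt => e e0; have e20 : 0 < e / 2 by rewrite divr_gt0.
  have [N hN] := simple_integral_close mA mf ft fs e20.
  have /cvgrPdist_lt/(_ _ e20)[M _ hM] := tv.
  exists N => // k /= Nk; have := hM (maxn N M); rewrite /= leq_maxr => /(_ isT) h1.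
  have h2 := hN (maxn N M) k (leq_maxl _ _) Nk.
  rewrite -(subrK (simple_integral P A (t (maxn N M))) v) -addrA.
  by rewrite (le_lt_trans (ler_normD _ _))// [e]splitr ltrD.
by case; exists s => //; exact: simple_integral_cvg fs.
Qed.

Lemma L1_approx_simple f : simple_fun f -> L1_approx P f (fun=> f).
Proof.
split=> //; under eq_fun do under eq_integral do rewrite subrr normr0.
by rewrite integral0; exact: cvg_cst.
Qed.

Lemma bochner_integral_simple f A : measurable A -> simple_fun f ->
  bochner_integral P A f = simple_integral P A f.
Proof.
move=> mA sf; have mf := finitely_valued_borel sf.
have := bochner_integral_cvg mA mf (L1_approx_simple sf).
by move=> /(cvg_lim (@norm_hausdorff _ X)); rewrite lim_cst.
Qed.

(** On a set A where u is within e of x, and over which u and g have the same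
    integral, the integral of 2u - g is that of u, hence close to P(A) x; so its norm
    is at least (|x| - e) P(A). The integrals are replaced by those of simple
    approximations t of u and s of g, through
    x + (t - s) = (2u - g) + (x - u) + (t - u) + (g - s). *)
Lemma bochner_integral_contract u g A (x : X) (e : R) : measurable A ->
  bochner_integrable P u -> bochner_integrable P g ->
  bochner_integral P A u = bochner_integral P A g ->
  0 <= e -> (forall w, A w -> `|u w - x| <= e) ->
  ((`|x| - e)%:E * P A <= \int[P]_(w in A) `|2 *: u w - g w|%:E)%E.
Proof.
move=> mA [mu [t ut]] [mg [s gs]] eug e0 ux.
have PA : P A \is a fin_num by rewrite fin_num_measure.
have m2ug : measurable_fun setT (fun w => (`|2 *: u w - g w|%:E)%E).
  by apply/measurable_EFinP/measurable_normB => //; exact: borel_measurableZ.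
have m2ugA : measurable_fun A (fun w => (`|2 *: u w - g w|%:E)%E).
  exact: measurable_funTS.
rewrite EFinB muleBl// ?fin_num_adde_defl// leeBlDr; last by rewrite fin_numM.
apply/lee_addgt0Pr => eta eta0.
have eta30 : 0 < eta / 3 by rewrite divr_gt0.
have cvg0 : simple_integral P A (t k) - simple_integral P A (s k)
    @[k --> \oo] --> (0 : X).
  rewrite -(subrr (bochner_integral P A g)) -{1}eug.
  exact: cvgB (bochner_integral_cvg mA mu ut) (bochner_integral_cvg mA mg gs).
have close := (cvgr0Pnorm_lt _).1 cvg0 _ eta30.
near \oo => k.
have hc : `|simple_integral P A (t k) - simple_integral P A (s k)| < eta / 3.
  by near: k; exact: close.
have ht : (\int[P]_w `|u w - t k w|%:E < (eta / 3)%:E)%E.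
  by near: k; exact: L1_approx_near.
have hs : (\int[P]_w `|g w - s k w|%:E < (eta / 3)%:E)%E.
  by near: k; exact: L1_approx_near.
have st := ut.1 k; have ss := gs.1 k.
have fts := finitely_valued_pair st ss.
have mt : measurable_fun setT (fun w => (`|u w - t k w|%:E)%E).
  by apply/measurable_EFinP/measurable_normB => //; exact: finitely_valued_borel.
have ms : measurable_fun setT (fun w => (`|g w - s k w|%:E)%E).
  by apply/measurable_EFinP/measurable_normB => //; exact: finitely_valued_borel.
pose q w := (t k w, s k w).
have mx : fine (P A) *: x =
    \sum_(y <- fset_set (range q)) fine (P (A `&` q @^-1` [set y])) *: x.
  have := @finitely_valued_measure _ _ _ P _ q A predT mA fts.
  rewrite (_ : q @^-1` _ = setT); last by apply/seteqP; split.
  rewrite setIT => ->; rewrite -sum_fine ?scaler_suml// => y _.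
  by rewrite fin_num_measure//; apply: measurableI => //; exact: fts.2.
have e1 : fine (P A) *: x =
    simple_integral P A (fun w => x + (t k w - s k w)) -
    (simple_integral P A (t k) - simple_integral P A (s k)).
  rewrite mx (@simple_integral_comp _ _ _ _ P _ q fst)//.
  rewrite (@simple_integral_comp _ _ _ _ P _ q snd)//.
  rewrite (@simple_integral_comp _ _ _ _ P _ q (fun y => x + (y.1 - y.2)))//.
  rewrite -!sumrB; apply: eq_bigr => y _.
  by rewrite -!scalerBr addrK.
have n1 := norm_simple_integral_le P (fun y : X * X => x + (y.1 - y.2)) mA fts.
have n2 : (\int[P]_(w in A) `|x + (t k w - s k w)|%:E <=
  \int[P]_(w in A) (`|2 *: u w - g w|%:E + cst e%:E w) +
    (\int[P]_w `|u w - t k w|%:E + \int[P]_w `|g w - s k w|%:E))%E.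
  rewrite -ge0_integralD//.
  apply: (@le_trans _ _ (\int[P]_(w in A) (`|2 *: u w - g w|%:E + cst e%:E w) +
      \int[P]_(w in A) (`|u w - t k w|%:E + `|g w - s k w|%:E))%E); last first.
    rewrite leeD2l// ge0_subset_integral//; first exact: emeasurable_funD.
    by move=> w _; rewrite adde_ge0// lee_fin.
  rewrite -ge0_integralD//; first last.
  - by apply: emeasurable_funD; exact: measurable_funTS.
  - by move=> w _; rewrite adde_ge0// lee_fin.
  - exact: emeasurable_funD.
  - by move=> w _; rewrite adde_ge0// lee_fin.
  apply: ge0_le_integral => //.
  - apply/measurable_EFinP/measurable_funTS.
    move=> _ B mB; rewrite setTI.
    exact: (finitely_valued_preimage ((fun y => `|x + (y.1 - y.2)|) @^-1` B) fts).
  - apply: emeasurable_funD; first exact: emeasurable_funD.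
    by apply: emeasurable_funD; exact: measurable_funTS.
  move=> w Aw; rewrite -!EFinD lee_fin /=.
  have -> : x + (t k w - s k w) =
      ((2 *: u w - g w) + (x - u w)) + ((t k w - u w) + (g w - s k w)).
    have -> : 2 *: u w - g w + (x - u w) = x + (u w - g w).
      by rewrite scaler_nat mulr2n [LHS]addrC -!addrA addKr.
    have -> : t k w - u w + (g w - s k w) = (g w - u w) + (t k w - s k w).
      by rewrite addrACA (addrC (t k w)) addrACA.
    by rewrite -(opprB (u w) (g w)) -[RHS]addrA addNKr.
  rewrite (le_trans (ler_normD _ _))// lerD//.
    by rewrite (le_trans (ler_normD _ _))// lerD2l distrC ux.
  by rewrite (le_trans (ler_normD _ _))// lerD2r distrC.
have e2 : (\int[P]_(w in A) (`|2 *: u w - g w|%:E + cst e%:E w) =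
    \int[P]_(w in A) `|2 *: u w - g w|%:E + e%:E * P A)%E.
  by rewrite ge0_integralD// integral_cst.
rewrite e2 in n2.
have n3 : (`|x|%:E * P A <= \int[P]_(w in A) `|x + (t k w - s k w)|%:E + (eta / 3)%:E)%E.
  apply: (@le_trans _ _ (`|simple_integral P A (fun w => x + (t k w - s k w))|%:E + (eta / 3)%:E)%E).
    rewrite -(fineK PA) -EFinM -EFinD lee_fin.
    have -> : `|x| * fine (P A) = `|fine (P A) *: x|.
      by rewrite normrZ ger0_norm ?fine_ge0// mulrC.
    by rewrite e1 (le_trans (ler_normB _ _))// lerD2l ltW.
  by rewrite leeD2r.
apply: (le_trans n3); apply: (le_trans (leeD2r _ n2)).
have thirds (a b c : \bar R) : (b <= (eta / 3)%:E -> c <= (eta / 3)%:E ->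
    a + (b + c) + (eta / 3)%:E <= a + eta%:E)%E.
  move=> b3 c3; rewrite -addeA leeD2l//.
  apply: (@le_trans _ _ ((eta / 3)%:E + (eta / 3)%:E + (eta / 3)%:E)%E).
    by rewrite leeD2r// leeD.
  by rewrite -!EFinD lee_fin; lra.
by apply: thirds; exact: ltW.
Unshelve. all: by end_near. Qed.

End bochner_integrals.

(** * The conditional Jensen inequality for powers of the norm *)

Section conditional_contraction.
Context {R : realType} {X : completeNormedModType R}.
Context {d : measure_display} {T : measurableType d} (P : probability T R).

(** Jensen's inequality on A in a form that avoids dividing by P(A): integrate the
    tangent inequality at c. *)
Lemma integral_powR_jensen (A : set T) (g : T -> R) (c p : R) :
  measurable A -> measurable_fun setT g -> (forall w, 0 <= g w) ->
  1 < p -> 0 <= c -> (c%:E * P A <= \int[P]_(w in A) (g w)%:E)%E ->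
  ((c `^ p)%:E * P A <= \int[P]_(w in A) (g w `^ p)%:E)%E.
Proof.
move=> mA mg g0 p1 c0 le.
have p0 : 0 < p by apply: lt_trans p1.
have PA : P A \is a fin_num by rewrite fin_num_measure.
have mgA : measurable_fun A g by exact: measurable_funTS.
have mgp : measurable_fun A (fun w => (g w `^ p)%:E).
  apply/measurable_EFinP.
  exact: (measurableT_comp (measurable_powR p) mgA).
have k0 : 0 <= p * c `^ (p - 1) by rewrite mulr_ge0 ?powR_ge0// ltW.
have cc : c * c `^ (p - 1) = c `^ p by rewrite mulr_powRB1.
have pc0 : 0 <= (p - 1) * c `^ p by rewrite mulr_ge0 ?powR_ge0// subr_ge0 ltW.
have tangent : (\int[P]_(w in A) ((p * c `^ (p - 1))%:E * (g w)%:E) <=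
    \int[P]_(w in A) ((g w `^ p)%:E + cst ((p - 1) * c `^ p)%:E w))%E.
  apply: ge0_le_integral => //.
  - by move=> w _; rewrite lee_fin mulr_ge0.
  - by apply/measurable_EFinP/measurable_funM.
  - exact: emeasurable_funD.
  - move=> w _; rewrite /= lee_fin.
    have := powR_tangent p1 c0 (g0 w); rewrite -cc; lra.
rewrite ge0_integralD// in tangent; last by move=> w _; rewrite lee_fin powR_ge0.
have icst : (\int[P]_(w in A) cst ((p - 1) * c `^ p)%:E w =
    ((p - 1) * c `^ p)%:E * P A)%E by rewrite integral_cst.
rewrite icst ge0_integralZl_EFin// in tangent; last 2 first.
  by move=> w _; rewrite lee_fin.
  exact/measurable_EFinP.
have kE : (0 <= (p * c `^ (p - 1))%:E)%E by rewrite lee_fin.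
have := le_trans (lee_wpmul2l kE le) tangent.
move: (P A) PA => PA; case: PA => //= PA _; set I := integral _ _ _.
case: I => [y|_|]//; last by rewrite leey.
rewrite -!EFinM -EFinD !lee_fin -cc; lra.
Qed.

Lemma borel_sets_closed_ball (x : X) (r : R) :
  borel_sets [set y : X | `|y - x| <= r].
Proof.
have -> : [set y : X | `|y - x| <= r] = ~` [set y : X | r < `|y - x|].
  by apply/seteqP; split => y /=; rewrite leNgt => /negP.
rewrite -setTD; apply: sigma_algebraCD; apply: sub_sigma_algebra => /=.
have cont : continuous (fun y : X => `|y - x|).
  by move=> y; apply: cvg_norm; apply: cvgB; [exact: cvg_id|exact: cvg_cst].
by move/continuousP : cont => /(_ [set z | r < z]); apply; exact: open_gt.
Qed.

(** Cut the space into countably many pieces on which u is within e|x| of some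
    fixed x, with e relative to |x| so that the error is a factor. On each piece
    |u| <= (1+e)|x|, while [bochner_integral_contract] and Jensen's inequality bound
    the integral of |2u - g|^p below by ((1-e)|x|)^p P(A). The ratio of the two is
    r^p, and the pieces are summed. *)
Lemma norm_powR_contract_approx (G : set (set T)) (u g : T -> X) (p r : R) :
  separable_space X -> G `<=` measurable -> borel_measurable G u ->
  bochner_integrable P u -> bochner_integrable P g ->
  (forall A, G A -> bochner_integral P A u = bochner_integral P A g) ->
  1 < p -> 1 < r ->
  (\int[P]_w (`|u w| `^ p)%:E <=
    (r `^ p)%:E * \int[P]_w (`|2 *: u w - g w| `^ p)%:E)%E.
Proof.
move=> sepX GT Gu iu ig eug p1 r1.
have p0 : 0 < p by apply: lt_trans p1.
(* This e is the solution of (1 + e) / (1 - e) = r. *)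
pose e := (r - 1) / (r + 1).
have rp : 0 < r + 1 by lra.
have e0 : 0 < e by rewrite divr_gt0// subr_gt0.
have e1 : e < 1 by rewrite ltr_pdivrMr//; lra.
have re : r * (1 - e) = 1 + e by rewrite /e; field; lra.
have [s sP] := separable_dense_seq sepX.
(* The centre 0 is added because the piece around c n is the single point 0
   when c n = 0, and a centre close to 0 in the relative sense exists only
   for nonzero points. *)
pose c n := if n is m.+1 then s m else 0.
pose U n := [set y : X | `|y - c n| <= e * `|c n|].
pose V := seqDU U.
have bV n : borel_sets (V n).
  apply: (@seqDU_measurable _ (g_sigma_algebraType [set U : set X | open U]) U).
  by move=> m; exact: borel_sets_closed_ball.
have UT : \bigcup_n U n = setT.
  apply/seteqP; split => // y _.
  have [->|y0] := eqVneq y 0; first by exists 0%N => //; rewrite /U /= subrr normr0 mulr0.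
  have dlt : 0 < e * `|y| / 2 by rewrite divr_gt0// mulr_gt0// normr_gt0.
  have [n yn] := sP y _ dlt; exists n.+1 => //; rewrite /U /=.
  have h : `|y| <= `|y - s n| + `|s n|.
    by rewrite -{1}(subrK (s n) y) ler_normD.
  have y1 : 0 < `|y| by rewrite normr_gt0.
  have h2 : `|y| / 2 <= `|s n| by nra.
  nra.
pose A n := u @^-1` V n.
have GA n : G (A n) by exact: Gu.
have mA n : measurable (A n) by exact: GT.
have AT : \bigcup_n A n = setT.
  by rewrite -preimage_bigcup -seqDU_bigcup_eq UT.
have tA : trivIset setT A.
  move=> i j _ _ [w [wi wj]].
  by apply: (@trivIset_seqDU _ U) => //; exists (u w).
have mu := iu.1; have mg := ig.1.
have mpow (h : T -> R) : measurable_fun setT h ->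
    measurable_fun setT (fun w => (h w `^ p)%:E).
  move=> mh; apply/measurable_EFinP.
  exact: (measurableT_comp (measurable_powR p) mh).
have mup := mpow _ (measurable_norm mu).
have mwp := mpow _ (measurable_normB sepX (borel_measurableZ 2 mu) mg).
have split (h : T -> R) : measurable_fun setT (fun w => (h w `^ p)%:E) ->
    (\int[P]_w (h w `^ p)%:E = \sum_(n <oo) \int[P]_(w in A n) (h w `^ p)%:E)%E.
  move=> mh; rewrite -AT ge0_integral_bigcup ?AT//.
  by move=> w _; rewrite lee_fin powR_ge0.
rewrite (split _ mup) (split _ mwp) -nneseriesZl; last first.
  by move=> n _; apply: integral_ge0 => w _; rewrite lee_fin powR_ge0.
apply: lee_nneseries => [n *|n _].
  by apply: integral_ge0 => w _; rewrite lee_fin powR_ge0.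
have uA w : A n w -> `|u w - c n| <= e * `|c n|.
  exact: (@subset_seqDU _ U n).
have ec0 : 0 <= e * `|c n| by rewrite mulr_ge0// ltW.
have := bochner_integral_contract sepX (mA n) iu ig (eug _ (GA n)) ec0 uA.
have -> : `|c n| - e * `|c n| = (1 - e) * `|c n| by rewrite mulrBl mul1r.
have ce0 : 0 <= (1 - e) * `|c n| by rewrite mulr_ge0// subr_ge0 ltW.
move=> /(integral_powR_jensen (mA n) (measurable_normB sepX (borel_measurableZ 2 mu) mg)
  (fun=> normr_ge0 _) p1 ce0) jensen.
apply: le_trans (lee_wpmul2l _ jensen); last by rewrite lee_fin powR_ge0.
rewrite muleA -EFinM -powRM//; last by lra.
rewrite mulrA re.
have <- : (\int[P]_(w in A n) cst (((1 + e) * `|c n|) `^ p)%:E w =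
  (((1 + e) * `|c n|) `^ p)%:E * P (A n))%E by rewrite integral_cst.
apply: ge0_le_integral => //; first exact: measurable_funTS.
move=> w Aw; rewrite lee_fin ge0_ler_powR ?nnegrE ?mulr_ge0// ?(ltW p0)//; first by lra.
have := uA w Aw; have := ler_normD (u w - c n) (c n); rewrite subrK; lra.
Qed.

(** Conditional Jensen's inequality: the hypotheses say that u is the conditional
    expectation of 2u - g given G. *)
Lemma norm_powR_contract (G : set (set T)) (u g : T -> X) (p : R) :
  separable_space X -> G `<=` measurable -> borel_measurable G u ->
  bochner_integrable P u -> bochner_integrable P g ->
  (forall A, G A -> bochner_integral P A u = bochner_integral P A g) ->
  1 < p ->
  (\int[P]_w (`|u w| `^ p)%:E <= \int[P]_w (`|2 *: u w - g w| `^ p)%:E)%E.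
Proof.
move=> sepX GT Gu iu ig eug p1.
have p0 : 0 < p by apply: lt_trans p1.
have := norm_powR_contract_approx sepX GT Gu iu ig eug p1.
have : (0 <= \int[P]_w (`|2 *: u w - g w| `^ p)%:E)%E.
  by apply: integral_ge0 => w _; rewrite lee_fin powR_ge0.
case: (\int[P]_w (`|2 *: u w - g w| `^ p)%:E)%E => [b|_ _|//]; last by rewrite leey.
rewrite lee_fin => b0 H; apply/lee_addgt0Pr => e e0.
(* Chosen so that q b <= b + e. *)
pose q := 1 + e / (b + 1).
have q1 : 1 < q by rewrite ltrDl divr_gt0//; lra.
have r1 : 1 < q `^ p^-1.
  have := @gt0_ltr_powR R p^-1 _ 1 q; rewrite powR1; apply=> //; rewrite ?invr_gt0 ?nnegrE//.
  by rewrite ltW// (lt_trans ltr01).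
apply: (le_trans (H _ r1)).
rewrite -powRrM mulVf ?gt_eqF// powRr1; last by lra.
rewrite -EFinM -EFinD lee_fin /q mulrDl mul1r lerD2l mulrAC ler_pdivrMr; last by lra.
by rewrite mulrDr lerDl mulr1 ltW.
Qed.

End conditional_contraction.

(** * Moments of martingales in smooth spaces *)

Section moments.
Context {R : realType} {d : measure_display} {T : measurableType d}.
Context (P : probability T R).
Implicit Types (g h : T -> R).

Lemma LnormE g (p : R) : (forall w, 0 <= g w) ->
  ('N[P]_p%:E [(fun w => (g w)%:E)] = (\int[P]_w (g w `^ p)%:E) `^ p^-1)%E.
Proof.
move=> g0; rewrite unlock; congr (_ `^ _)%E; apply: eq_integral => w _.
by rewrite gee0_abs ?lee_fin// poweR_EFin.
Qed.

(** Minkowski's inequality stated through q-th powers of real bounds a and b on the norms,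
    which keeps the roots of extended reals inside this proof. *)
Lemma integral_powR_minkowski g h (q a b : R) :
  measurable_fun setT g -> measurable_fun setT h ->
  (forall w, 0 <= g w) -> (forall w, 0 <= h w) -> 1 <= q -> 0 <= a -> 0 <= b ->
  (\int[P]_w (g w `^ q)%:E <= (a `^ q)%:E)%E ->
  (\int[P]_w (h w `^ q)%:E <= (b `^ q)%:E)%E ->
  (\int[P]_w ((g w + h w) `^ q)%:E <= ((a + b) `^ q)%:E)%E.
Proof.
move=> mg mh g0 h0 q1 a0 b0 ga hb.
have q0 : 0 < q by apply: lt_le_trans q1.
have norm_le (k : T -> R) (c : R) : (forall w, 0 <= k w) -> 0 <= c ->
    (\int[P]_w (k w `^ q)%:E <= (c `^ q)%:E)%E ->
    ('N[P]_q%:E [EFin \o k] <= c%:E)%E.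
  move=> k0 c0 kc; rewrite LnormE//.
  have <- : ((c `^ q)%:E `^ q^-1 = c%:E)%E.
    by rewrite poweR_EFin -powRrM divff ?gt_eqF// powRr1.
  apply: gt0_ler_poweR => //; rewrite ?invr_ge0 ?(ltW q0)// in_itv/= leey andbT.
    by apply: integral_ge0 => w _; rewrite lee_fin powR_ge0.
  by rewrite lee_fin powR_ge0.
have gh0 w : 0 <= g w + h w by rewrite addr_ge0.
have := le_trans (minkowski_EFin P mg mh q1) (leeD (norm_le _ _ g0 a0 ga) (norm_le _ _ h0 b0 hb)).
rewrite -EFinD => le.
have <- : (('N[P]_q%:E [EFin \o (g \+ h)%R]) `^ q = \int[P]_w ((g w + h w) `^ q)%:E)%E.
  rewrite LnormE// -poweRrM mulVf ?gt_eqF// poweRe1//.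
  by apply: integral_ge0 => w _; rewrite lee_fin powR_ge0.
rewrite -poweR_EFin; apply: gt0_ler_poweR => //; rewrite ?(ltW q0)//.
  by rewrite in_itv/= leey andbT Lnorm_ge0.
by rewrite in_itv/= leey andbT lee_fin addr_ge0.
Qed.

Lemma measurable_EFin_powR g (p : R) : measurable_fun setT g ->
  measurable_fun setT (fun w => (g w `^ p)%:E).
Proof.
move=> mg; apply/measurable_EFinP.
exact: (measurableT_comp (measurable_powR p) mg).
Qed.

End moments.

Lemma sqr_powR (R : realType) (x p : R) : 0 <= x -> (x ^+ 2) `^ (p / 2) = x `^ p.
Proof.
by move=> x0; rewrite -powR_mulrn// -powRrM; congr (_ `^ _); field.
Qed.

Lemma ler_powR_inv (R : realType) (x y q : R) : 0 < q -> 0 <= x -> 0 <= y ->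
  x `^ q <= y `^ q -> x <= y.
Proof.
move=> q0 x0 y0 xy; rewrite leNgt; apply/negP => yx.
have xn : x \in Num.nneg by rewrite nnegrE.
have yn : y \in Num.nneg by rewrite nnegrE.
by have := gt0_ltr_powR q0 yn xn yx; rewrite ltNge xy.
Qed.

Section martingale_moments.
Context {R : realType} {X : completeNormedModType R}.
Context {d : measure_display} {T : measurableType d} (P : probability T R).

(** Combine [smooth2_powR] at x = u, y = g - u, Minkowski's inequality and
    E|u|^p <= E|2u - g|^p. Writing E|g|^p = c^(p/2), this gives
    c^(p/2) + a^(p/2) <= 2 (a + K b)^(p/2) with K = 25 p D^2, hence by convexity
    (c + a)/2 <= a + K b. Here a, b and c are squares of L^p norms. *)
Lemma smooth_moment_step (G : set (set T)) (u g : T -> X) (D p a b : R) :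
  separable_space X -> smooth2 X D -> 1 <= D -> 2 < p ->
  G `<=` measurable -> borel_measurable G u ->
  bochner_integrable P u -> bochner_integrable P g ->
  (forall A, G A -> bochner_integral P A u = bochner_integral P A g) ->
  0 <= a -> 0 <= b ->
  (\int[P]_w (`|u w| `^ p)%:E = (a `^ (p / 2))%:E)%E ->
  (\int[P]_w (`|g w - u w| `^ p)%:E = (b `^ (p / 2))%:E)%E ->
  exists c, [/\ 0 <= c, (\int[P]_w (`|g w| `^ p)%:E = (c `^ (p / 2))%:E)%E &
    c <= a + 50 * p * D ^+ 2 * b].
Proof.
move=> sepX smX D1 p2 GT Gu iu ig eug a0 b0 ua gb.
have q1 : 1 < p / 2 by lra.
have q0 : 0 < p / 2 by lra.
have p0 : 0 < p by lra.
have p1 : 1 < p by lra.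
pose K := 25 * p * D ^+ 2.
have K0 : 0 <= K by rewrite mulr_ge0 ?sqr_ge0//; lra.
have mu := iu.1; have mg := ig.1.
have mu' := measurable_norm mu; have mg' := measurable_norm mg.
have md := measurable_normB sepX mg mu.
have mr := measurable_normB sepX (borel_measurableZ 2 mu) mg.
have msq (h : T -> R) : measurable_fun setT h -> measurable_fun setT (fun w => h w ^+ 2).
  by move=> mh; exact: measurable_funX.
have contract := norm_powR_contract sepX GT Gu iu ig eug p1.
have mink : (\int[P]_w ((`|u w| ^+ 2 + K * `|g w - u w| ^+ 2) `^ (p / 2))%:E <=
    ((a + K * b) `^ (p / 2))%:E)%E.
  apply: integral_powR_minkowski => //; rewrite ?(ltW q1)//.
  - exact: msq.
  - by apply: measurable_funM => //; exact: msq.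
  - by move=> w; rewrite mulr_ge0// sqr_ge0.
  - by rewrite mulr_ge0.
  - by rewrite -ua; under eq_integral do rewrite sqr_powR//.
  - rewrite powRM// EFinM -gb -ge0_integralZl_EFin ?powR_ge0//.
    + rewrite le_eqVlt; apply/predU1P; left; apply: eq_integral => w _.
      by rewrite -EFinM powRM ?sqr_ge0// sqr_powR.
    + exact: measurable_EFin_powR.
have main : (\int[P]_w (`|g w| `^ p)%:E + (a `^ (p / 2))%:E <=
    (2 * (a + K * b) `^ (p / 2))%:E)%E.
  apply: le_trans (leeD2l _ (_ : _ <= \int[P]_w (`|2 *: u w - g w| `^ p)%:E)%E) _.
    by rewrite -ua.
  rewrite -ge0_integralD//; first last.
  - exact: measurable_EFin_powR.
  - exact: measurable_EFin_powR.
  rewrite EFinM; apply: le_trans (lee_wpmul2l _ mink); last by rewrite lee_fin.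
  rewrite -ge0_integralZl_EFin//; first last.
  - apply: measurable_EFin_powR; apply: measurable_funD; first exact: msq.
    by apply: measurable_funM => //; exact: msq.
  - by move=> w _; rewrite lee_fin powR_ge0.
  apply: ge0_le_integral => //.
  - by move=> w _; rewrite adde_ge0// lee_fin powR_ge0.
  - by apply: emeasurable_funD; exact: measurable_EFin_powR.
  - apply: measurable_funeM.
    apply: measurable_EFin_powR; apply: measurable_funD; first exact: msq.
    by apply: measurable_funM => //; exact: msq.
  move=> w _; rewrite -EFinD -EFinM lee_fin.
  have := smooth2_powR (u w) (g w - u w) smX D1 (ltW p2).
  have -> : u w + (g w - u w) = g w by rewrite addrC subrK.
  have -> : u w - (g w - u w) = 2 *: u w - g w.
    by rewrite opprB addrA scaler_nat mulr2n.
  exact.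
have : (0 <= \int[P]_w (`|g w| `^ p)%:E)%E.
  by apply: integral_ge0 => w _; rewrite lee_fin powR_ge0.
case: (\int[P]_w (`|g w| `^ p)%:E)%E main => [y| |]//.
rewrite -EFinD !lee_fin => main y0.
pose c := y `^ (p / 2)^-1; have c0 : 0 <= c by rewrite powR_ge0.
have yE : y = c `^ (p / 2) by rewrite -powRrM mulVf ?gt_eqF// powRr1.
exists c; split; rewrite -?yE//.
have := powR_mean2 q1 c0 a0; rewrite -yE => /le_trans/(_ main).
rewrite ler_pM2l// => /ler_powR_inv; rewrite /K => le.
have {}le : (c + a) / 2 <= a + 25 * p * D ^+ 2 * b.
  by apply: le => //; [lra|rewrite addr_ge0// mulr_ge0].
lra.
Qed.

End martingale_moments.

Section square_function.
Context {R : realType} {X : completeNormedModType R}.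
Context {d : measure_display} {T : measurableType d} (P : probability T R).
Implicit Types (f : nat -> T -> X) (p : R) (n : nat).

Lemma Sp_stopped f p n w : p != 0 -> (forall k, (n <= k)%N -> f k = f n) ->
  Sp p f w = ((\sum_(i < n) `|f i.+1 w - f i w| `^ p) `^ p^-1)%:E.
Proof.
move=> p0 fn; rewrite /Sp -poweR_EFin; congr (_ `^ _)%E.
apply: lim_near_cst => //.
exists n.+1 => // m /= nm.
rewrite (@big_cat_nat _ _ _ n.+1)//= [X in (_ + X)%E]big1_seq ?adde0; last first.
  move=> j /andP[_]; rewrite mem_index_iota => /andP[nj _].
  have nj1 : (n <= j.-1)%N by case: j nj.
  rewrite (fn _ (ltnW nj)) (fn _ nj1).
  by rewrite subrr normr0 powR0.
by rewrite big_add1/= big_mkord sumEFin.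
Qed.

Lemma Lnorm_Sp_stopped f p n : 0 < p -> separable_space X ->
  (forall j, borel_measurable measurable (f j)) ->
  (forall k, (n <= k)%N -> f k = f n) ->
  ('N[P]_p%:E [Sp p f] =
    (\sum_(i < n) \int[P]_w (`|f i.+1 w - f i w| `^ p)%:E) `^ p^-1)%E.
Proof.
move=> p0 sepX mf fn.
have pn0 : p != 0 by rewrite gt_eqF.
rewrite (@eq_Lnorm _ _ _ _ _ _ (fun w => ((\sum_(i < n) `|f i.+1 w - f i w| `^ p) `^ p^-1)%:E)); last first.
  by move=> w; exact: Sp_stopped.
rewrite LnormE; last by move=> w; rewrite powR_ge0.
congr (_ `^ _)%E.
have S0 w : 0 <= \sum_(i < n) `|f i.+1 w - f i w| `^ p.
  by rewrite sumr_ge0// => i _; rewrite powR_ge0.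
under eq_integral do rewrite -powRrM mulVf// powRr1// -sumEFin.
rewrite ge0_integral_sum// => i.
by apply: measurable_EFin_powR; exact: measurable_normB.
Qed.

End square_function.

Section upper_bound.
Context {R : realType} {X : completeNormedModType R}.
Context {d : measure_display} {T : measurableType d} (P : probability T R).
Context (p D : R) (F : nat -> set (set T)) (f : nat -> T -> X).
Context (p2 : 2 < p) (sepX : separable_space X) (smX : smooth2 X D) (D1 : 1 <= D).
Context (mgf : martingale0 P F f) (y : nat -> R).
Context (yE : forall i, (\int[P]_w (`|f i.+1 w - f i w| `^ p)%:E = (y i)%:E)%E).

Let p0 : 0 < p. Proof. exact: lt_trans p2. Qed.

Let y0 i : 0 <= y i.
Proof.
by rewrite -lee_fin -yE; apply: integral_ge0 => w _; rewrite lee_fin powR_ge0.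
Qed.

(** Iterate [smooth_moment_step]; y i ^ (2/p) is the square of the L^p norm of
    the increment from time i to i+1. *)
Lemma martingale_moment_smooth j : exists c,
  [/\ 0 <= c, (\int[P]_w (`|f j w| `^ p)%:E = (c `^ (p / 2))%:E)%E &
    c <= 50 * p * D ^+ 2 * \sum_(i < j) y i `^ (2 / p)].
Proof.
have [filF mF iF ceF f0] := mgf; have [_ FT _] := filF.
elim: j => [|j [a [a0 aE ale]]].
  exists 0; split=> //; last by rewrite big_ord0 mulr0.
  rewrite powR0; last by rewrite gt_eqF// divr_gt0.
  under eq_integral do rewrite f0 normr0 powR0 ?gt_eqF//.
  by rewrite integral0.
have ceE A : F j A -> bochner_integral P A (f j) = bochner_integral P A (f j.+1).
  by case: (ceF j) => _ _; exact.
have b0 : 0 <= y j `^ (2 / p) by rewrite powR_ge0.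
have bE : (\int[P]_w (`|f j.+1 w - f j w| `^ p)%:E = ((y j `^ (2 / p)) `^ (p / 2))%:E)%E.
  by rewrite yE -powRrM mulrA divfK ?gt_eqF// divff// powRr1.
have [c [c0 cE cle]] := smooth_moment_step sepX smX D1 p2 (FT j) (mF j) (iF j)
  (iF j.+1) ceE a0 b0 aE bE.
exists c; split=> //; rewrite big_ord_recr/= mulrDr.
by apply: (le_trans cle); rewrite lerD2r.
Qed.

Lemma norm_sum_increments n w : `|f n w| <= \sum_(i < n) `|f i.+1 w - f i w|.
Proof.
have [_ _ _ _ f0] := mgf.
elim: n => [|n IH]; first by rewrite big_ord0 f0 normr0.
rewrite big_ord_recr/= -{1}(subrK (f n w) (f n.+1 w)) addrC.
by rewrite (le_trans (ler_normD _ _))// lerD2l.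
Qed.

Lemma martingale_moment_triangle n : (0 < n)%N ->
  (\int[P]_w (`|f n w| `^ p)%:E <= (n%:R `^ (p - 1) * \sum_(i < n) y i)%:E)%E.
Proof.
move=> n0; have [filF mF iF ceF f0] := mgf.
have mf j : borel_measurable measurable (f j) := (iF j).1.
have mi (i : nat) := measurable_EFin_powR p (measurable_normB sepX (mf i.+1) (mf i)).
rewrite EFinM -sumEFin.
under eq_bigr do rewrite -yE.
rewrite -ge0_integral_sum//.
rewrite -ge0_integralZl_EFin ?powR_ge0//; first last.
- by apply: emeasurable_sum => i; exact: mi.
- by move=> w _; apply: sume_ge0 => i _; rewrite lee_fin powR_ge0.
apply: ge0_le_integral => //.
- exact/measurable_EFin_powR/measurable_norm.
- by apply: measurable_funeM; apply: emeasurable_sum => i; exact: mi.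
move=> w _; rewrite sumEFin -EFinM lee_fin.
have p1 : 1 < p by apply: lt_trans p2; rewrite ltr1n.
apply: le_trans (powR_mean p1 n0 (fun i => normr_ge0 (f i.+1 w - f i w))).
apply: ge0_ler_powR; rewrite ?nnegrE ?sumr_ge0 ?norm_sum_increments//; exact: ltW.
Qed.

End upper_bound.

(** * The upper rate *)

Section rate.
Context {R : realType} (p : R) (n : nat).
Context (p2 : 2 < p) (n0 : (0 < n)%N).

Let n0' : 0 < n%:R :> R. Proof. by rewrite ltr0n. Qed.

(** Hoelder's inequality between the exponents 2 and p for the norms of the
    increments produces n^((p-2)/p); the remaining constant is sqrt 50 <= 8. *)
Lemma rate_sqrt_sum (D a : R) (y : nat -> R) : 0 < D -> 0 < a ->
  (forall i, 0 <= y i) -> \sum_(i < n) y i = (a / D) `^ p ->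
  Num.sqrt (50 * p * D ^+ 2 * \sum_(i < n) y i `^ (2 / p)) <=
    8 * Num.sqrt p * n%:R `^ ((p - 2) / (2 * p)) * a.
Proof.
move=> D0 a0 y0 yS.
have p0 : 0 < p by apply: lt_trans p2.
have q1 : 1 < p / 2 by rewrite ltr_pdivlMr// mul1r.
have q0 : 0 < p / 2 by rewrite divr_gt0.
have aD : 0 < a / D by rewrite divr_gt0.
set S := \sum_(i < n) _.
have S0 : 0 <= S by rewrite sumr_ge0// => i _; rewrite powR_ge0.
have SE : S <= n%:R `^ ((p - 2) / p) * (a / D) ^+ 2.
  apply: (@ler_powR_inv _ _ _ (p / 2)) => //.
    by rewrite mulr_ge0 ?powR_ge0 ?sqr_ge0.
  apply: (le_trans (powR_mean q1 n0 (fun i => powR_ge0 (y i) (2 / p)))).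
  rewrite powRM ?powR_ge0 ?sqr_ge0// sqr_powR ?(ltW aD)// -yS.
  rewrite le_eqVlt; apply/predU1P; left; congr (_ * _).
    by rewrite -powRrM; congr (_ `^ _); field; lra.
  apply: eq_bigr => i _; rewrite -powRrM.
  by rewrite (_ : _ * _ = 1) ?powRr1//; field; lra.
pose N := n%:R `^ ((p - 2) / (2 * p)) : R.
have N0 : 0 <= N by rewrite powR_ge0.
have NE : n%:R `^ ((p - 2) / p) = N ^+ 2.
  rewrite -powR_mulrn// -powRrM; congr (_ `^ _); field; lra.
have rhs0 : 0 <= 8 * Num.sqrt p * N * a by rewrite !mulr_ge0 ?sqrtr_ge0// ltW.
rewrite -/N -(ger0_norm rhs0) -sqrtr_sqr ler_wsqrtr//.
have -> : (8 * Num.sqrt p * N * a) ^+ 2 = 64 * p * D ^+ 2 * (N ^+ 2 * (a / D) ^+ 2).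
  rewrite !exprMn sqr_sqrtr ?(ltW p0)//; field; lra.
rewrite -NE; apply: (@le_trans _ _ (64 * p * D ^+ 2 * S)).
  by rewrite ler_wpM2r// ler_wpM2r ?sqr_ge0// ler_wpM2r// ?ler_nat// ltW.
by rewrite ler_wpM2l// mulr_ge0 ?sqr_ge0//; lra.
Qed.

Lemma rate_triangle : (n%:R `^ (p - 1)) `^ p^-1 =
  Num.sqrt n%:R * n%:R `^ ((p - 2) / (2 * p)) :> R.
Proof.
have p0 : 0 < p by apply: lt_trans p2.
rewrite -powR12_sqrt ?(ltW n0')// -powRrM -powRD ?(gt_eqF n0') ?implybT//.
by congr (_ `^ _); field; lra.
Qed.

End rate.

Section upper_rate.
Context {R : realType} {X : completeNormedModType R}.
Context {d : measure_display} {T : measurableType d} (P : probability T R).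

(** Each factor of the minimum comes from one of the two moment bounds: p from
    smoothness and n from the triangle inequality. *)
Lemma martingale_upper_rate (p a D : R) (n : nat) (F : nat -> set (set T))
    (f : nat -> T -> X) : 2 < p -> 0 < a -> (0 < n)%N -> 0 < D ->
  separable_space X -> smooth2 X D -> martingale0 P F f ->
  (forall k, (n <= k)%N -> f k = f n) ->
  (D%:E * 'N[P]_p%:E [Sp p f] = a%:E)%E ->
  ('N[P]_p%:E [(fun w => `|f n w|%:E)] <=
    (8 * Num.sqrt (Num.min p n%:R) * n%:R `^ ((p - 2) / (2 * p)) * a)%:E)%E.
Proof.
move=> p2 a0 n0 D0 sepX smX mgf fn Da.
have p0 : 0 < p by lra.
have pn0 : p != 0 by rewrite gt_eqF.
have mf j : borel_measurable measurable (f j) by case: mgf => _ _ /(_ j) [].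
pose J i := (\int[P]_w (`|f i.+1 w - f i w| `^ p)%:E)%E.
have J0 i : (0 <= J i)%E by apply: integral_ge0 => w _; rewrite lee_fin powR_ge0.
have SJ : (\sum_(i < n) J i = ((a / D) `^ p)%:E)%E.
  have : ('N[P]_p%:E [Sp p f] = (a / D)%:E)%E.
    rewrite mulrC EFinM -Da muleA -EFinM mulVf ?gt_eqF// mul1e//.
  rewrite (Lnorm_Sp_stopped P p0 sepX mf fn) -/J => /(congr1 (fun x => x `^ p)%E).
  rewrite -poweRrM mulVf// poweRe1 ?poweR_EFin//.
  by apply: sume_ge0 => i _; exact: J0.
have D1 : 1 <= D.
  have [[y y0]|X0] := pselect (exists y : X, y != 0); first exact: smooth2_ge1 smX D0 y0.
  have z (x : X) : x = 0 by apply/eqP/negPn/negP => x0; apply: X0; exists x.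
  have : ((a / D) `^ p)%:E = 0%E :> \bar R.
    rewrite -SJ big1// => i _; rewrite /J; under eq_integral do
      rewrite (z (_ - _)) normr0 powR0//.
    by rewrite integral0.
  by move=> [] /powR_eq0_eq0 /eqP; rewrite gt_eqF// divr_gt0.
pose y i := fine (J i).
have yE i : J i = (y i)%:E.
  rewrite fineK//; have [ni|ni] := leqP n i.
    rewrite /J (fn i ni) (fn i.+1 (leqW ni)).
    under eq_integral do rewrite subrr normr0 powR0//.
    by rewrite integral0.
  rewrite ge0_fin_numE//; apply: le_lt_trans (ltry ((a / D) `^ p)).
  rewrite -SJ (bigD1 (Ordinal ni))//= leeDl//.
  by apply: sume_ge0 => j _; exact: J0.
have y0 i : 0 <= y i by rewrite fine_ge0.
have yS : \sum_(i < n) y i = (a / D) `^ p.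
  apply: EFin_inj; rewrite -SJ -sumEFin; by apply: eq_bigr => i _; rewrite yE.
have aD : 0 < a / D by rewrite divr_gt0.
rewrite LnormE//; rewrite minEle; case: ifPn => [_|_].
  have [c [c0 cE cle]] := martingale_moment_smooth p2 sepX smX D1 mgf yE n.
  rewrite cE poweR_EFin lee_fin -powRrM (_ : p / 2 * p^-1 = 2^-1); last by field; lra.
  rewrite powR12_sqrt// (le_trans (ler_wsqrtr cle))//.
  exact: rate_sqrt_sum yS.
have le := martingale_moment_triangle p2 sepX mgf yE n0.
apply: (@le_trans _ _ ((n%:R `^ (p - 1) * (a / D) `^ p) `^ p^-1)%:E).
  rewrite -poweR_EFin -yS; apply: gt0_ler_poweR => //; rewrite ?invr_ge0 ?(ltW p0)//.
    rewrite in_itv/= leey andbT.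
    by apply: integral_ge0 => w _; rewrite lee_fin powR_ge0.
  by rewrite in_itv/= leey andbT lee_fin mulr_ge0 ?powR_ge0// sumr_ge0.
rewrite lee_fin powRM ?powR_ge0// -(powRrM (a / D)) divff// powRr1 ?(ltW aD)//.
rewrite rate_triangle// -[leRHS]mulrA -[leRHS]mulrA.
rewrite -[X in X <= _]mul1r ler_pM//; [|by rewrite ler1n|].
  by rewrite !mulr_ge0 ?sqrtr_ge0 ?powR_ge0 ?invr_ge0 ?ltW.
rewrite -mulrA ler_wpM2l ?sqrtr_ge0// ler_wpM2l ?powR_ge0//.
by rewrite ler_pdivrMr// ler_peMr// ltW.
Qed.

End upper_rate.

(** * Even moments of a symmetric step *)

Section even_moments.
Context {R : realType}.

(** The right side is the polynomial whose coefficients are the even binomial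
    coefficients, of which two terms are kept. Rather than expanding, the even and odd
    parts are followed through the recursion (x + 1)^2 = (x^2 + 1) + 2x and
    (x - 1)^2 = (x^2 + 1) - 2x. *)
Lemma even_power_two_point (x : R) (k : nat) :
  x ^+ (2 * k.+1) + (k.+1 * (2 * k).+1)%:R * x ^+ (2 * k) <=
    ((x + 1) ^+ (2 * k.+1) + (x - 1) ^+ (2 * k.+1)) / 2.
Proof.
pose ev m := ((x + 1) ^+ (2 * m) + (x - 1) ^+ (2 * m)) / 2.
pose od m := x * ((x + 1) ^+ (2 * m) - (x - 1) ^+ (2 * m)) / 2.
have evS m : ev m.+1 = (x ^+ 2 + 1) * ev m + 2 * od m.
  by rewrite /ev /od mulnS !exprD; field.
have odS m : od m.+1 = (x ^+ 2 + 1) * od m + 2 * x ^+ 2 * ev m.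
  by rewrite /ev /od mulnS !exprD; field.
have xx m : 0 <= x ^+ (2 * m) by rewrite mulnC exprM sqr_ge0.
have x2 : 0 <= x ^+ 2 by rewrite sqr_ge0.
have xS m : x ^+ (2 * m.+1) = x ^+ 2 * x ^+ (2 * m) by rewrite mulnS exprD.
rewrite -/(ev k.+1).
suff [] : x ^+ (2 * k.+1) + (k.+1 * (2 * k).+1)%:R * x ^+ (2 * k) <= ev k.+1 /\
    (2 * k.+1)%:R * x ^+ (2 * k.+1) <= od k.+1 by [].
elim: k => [|k [IHe IHo]].
  by rewrite evS odS /ev /od muln0 expr0 muln1 mul1n; split; nra.
have aS : (k.+2 * (2 * k.+1).+1)%:R =
    (k.+1 * (2 * k).+1)%:R + 1 + 2 * (2 * k.+1)%:R :> R.
  by rewrite -[1]/(1%:R) -[2]/(2%:R) -natrM -!natrD; congr (_%:R); lia.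
have bS : (2 * k.+2)%:R = (2 * k.+1)%:R + 2 :> R.
  by rewrite -[2]/(2%:R) -natrD; congr (_%:R); lia.
have a0 : 0 <= (k.+1 * (2 * k).+1)%:R :> R by [].
have b0 : 0 <= (2 * k.+1)%:R :> R by [].
have YE := xS k; have Y0 := xx k.+1; have Z0 := xx k.
rewrite (evS k.+1) (odS k.+1) (xS k.+1) aS bS.
move: (ev k.+1) (od k.+1) (x ^+ (2 * k.+1)) (x ^+ (2 * k)) (x ^+ 2)
  (k.+1 * (2 * k).+1)%:R (2 * k.+1)%:R IHe IHo x2 a0 b0 YE Y0 Z0.
move=> E O Y Z s a b IHe IHo s0 a0 b0 YE Y0 Z0 {aS bS xx xS evS odS}.
have sE : s * Y + a * Y <= s * E.
  by rewrite {2}YE mulrCA -mulrDr ler_wpM2l.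
have sO : s * (b * Y) <= s * O by rewrite ler_wpM2l.
have aZ : 0 <= a * Z by rewrite mulr_ge0.
have aY : 0 <= a * Y by rewrite mulr_ge0.
have bY : 0 <= b * Y by rewrite mulr_ge0.
by split; lra.
Qed.

End even_moments.

Section falling_factorials.

Lemma expn_le_ffact n m : (m <= n)%N -> ((n - m) ^ m <= n ^_ m)%N.
Proof.
elim: m n => [|m IH] [|n]// mn; rewrite expnS ffactSS.
by rewrite subSS leq_mul ?IH// (leq_trans (leq_subr _ _)).
Qed.

(** Indeed C(n,k) (2k)! is the product of the falling factorials of length k of n
    and of 2k, whose factors are at least n - k and k. *)
Lemma bin_double_fact n k : (k <= n)%N ->
  ((n - k) ^ k * k ^ k <= 'C(n, k) * (2 * k)`!)%N.
Proof.
move=> kn; rewrite -(@ffact_fact (2 * k) k); last by rewrite leq_pmull.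
have -> : (2 * k - k = k)%N by rewrite mul2n -addnn addnK.
rewrite (mulnC ((2 * k) ^_ k)) mulnA bin_ffact leq_mul ?expn_le_ffact//.
have := @expn_le_ffact (2 * k) k; rewrite mul2n -addnn addnK; apply.
by rewrite leq_addr.
Qed.

End falling_factorials.

(** * The uniform probability on the discrete cube *)

Definition cube (n : nat) : Type := {ffun 'I_n -> bool}.

HB.instance Definition _ n := Finite.on (cube n).
HB.instance Definition _ n := isPointed.Build (cube n) [ffun=> false].
HB.instance Definition _ n := @isMeasurable.Build default_measure_display
  (cube n) discrete_measurable discrete_measurable0
  discrete_measurableC discrete_measurableU.

Section uniform_measure.
Context {R : realType} (n : nat).

Let weight_ge0 : 0 <= (2 ^- n : R). Proof. by rewrite invr_ge0 exprn_ge0. Qed.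

(** A normalised sum of Dirac masses, so that the measure axioms and the formula for
    integrals follow from those of Dirac measures. *)
Definition cube_measure : set (cube n) -> \bar R :=
  mscale (NngNum weight_ge0)
    (msum (fun k => \d_(nth point (enum {: cube n}) k)) #|{: cube n}|).

HB.instance Definition _ := Measure.on cube_measure.

Definition cube_mean (g : cube n -> R) : R := 2 ^- n * \sum_w g w.

Lemma integral_cube (g : cube n -> R) : (forall w, 0 <= g w) ->
  (\int[cube_measure]_w (g w)%:E)%E = (cube_mean g)%:E.
Proof.
move=> g0; rewrite ge0_integral_mscale//=; last by move=> w _; rewrite lee_fin.
rewrite ge0_integral_measure_sum//; last by move=> w _; rewrite lee_fin.
rewrite /cube_mean EFinM; congr (_ * _)%E.
under eq_bigr do rewrite integral_dirac// diracT mul1e.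
rewrite sumEFin; congr EFin.
by rewrite -[RHS]big_enum/= [RHS](big_nth point) -cardE big_mkord.
Qed.

Lemma cube_measureE (A : set (cube n)) :
  cube_measure A = (cube_mean \1_A)%:E.
Proof.
rewrite -integral_cube// integral_indic// setIT//.
Qed.

Lemma cube_measureT : cube_measure setT = 1%E.
Proof.
rewrite cube_measureE /cube_mean indicT; congr EFin.
by rewrite sumr_const card_ffun card_bool card_ord natrX mulVf//.
Qed.

HB.instance Definition _ :=
  Measure_isProbability.Build _ _ _ cube_measure cube_measureT.

End uniform_measure.

(** * Moments of the simple random walk *)

Section random_walk.
Context {R : realType} (n : nat).
Implicit Types (w : cube n) (j : 'I_n) (g : cube n -> R).

Lemma cube_finitely_valued (Y : Type) (q : cube n -> Y) : finitely_valued q.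
Proof. by split=> //; apply: finite_image; exact: finite_finset. Qed.

Definition cube_flip j w : cube n := [ffun i => if i == j then ~~ w i else w i].

Lemma cube_flipK j : involutive (cube_flip j).
Proof.
move=> w; apply/ffunP => i; rewrite !ffunE.
by case: eqP => // _; rewrite negbK.
Qed.

(** Flipping one coordinate preserves the uniform probability; this symmetry replaces
    independence of the coins. *)
Lemma cube_mean_flip j g : cube_mean (fun w => g (cube_flip j w)) = cube_mean g.
Proof.
rewrite /cube_mean [in RHS](reindex_inj (inv_inj (cube_flipK j))).
by [].
Qed.

Definition coin w j : R := (-1) ^+ w j.

Lemma coin_flip j w : coin (cube_flip j w) j = - coin w j.
Proof. by rewrite /coin ffunE eqxx; case: (w j); rewrite /= ?expr1 ?expr0 ?opprK. Qed.

Definition walk (k : nat) w : R := \sum_(i < n | (i < k)%N) coin w i.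

Lemma walk0 w : walk 0 w = 0.
Proof. by rewrite /walk big_pred0. Qed.

Lemma walkS j w : walk j.+1 w = walk j w + coin w j.
Proof.
rewrite /walk (bigD1 j)//= addrC; congr (_ + _).
by apply: eq_bigl => i; rewrite ltnS ltn_neqAle andbC.
Qed.

Lemma walk_stop (k : nat) w : (n <= k)%N -> walk k w = walk n w.
Proof.
move=> nk; apply: eq_bigl => i; rewrite ltn_ord.
by rewrite (leq_trans (ltn_ord i)).
Qed.

Definition agree (k : nat) (w w' : cube n) := forall i : 'I_n, (i < k)%N -> w i = w' i.

(** The events that depend only on the first k coordinates, described as the sets
    saturated for agreement on these coordinates. *)
Definition coin_filtration (k : nat) : set (set (cube n)) :=
  [set A | forall w w', agree k w w' -> A w -> A w'].

Lemma walk_agree k w w' : agree k w w' -> walk k w = walk k w'.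
Proof. by move=> ww; apply: eq_bigr => i ik; rewrite /coin ww. Qed.

Lemma agree_flip j w : agree j (cube_flip j w) w.
Proof. by move=> i ij; rewrite ffunE; case: eqP ij => // ->; rewrite ltnn. Qed.

Lemma coin_filtrationP : filtration coin_filtration.
Proof.
split=> // [k|i j ij A FA w w' ww].
  split=> [//|A FA w w' ww [_ nAw]|A FA w w' ww [m _ Amw]].
    by split=> // Aw'; apply: nAw; apply: FA Aw' => i ik; rewrite ww.
  by exists m => //; apply: FA Amw.
by apply: FA => k ki; apply: ww; exact: leq_trans ij.
Qed.

(** The flip of coordinate j preserves every event of the past and changes
    the sign of the coin. *)
Lemma cube_mean_coin0 j (A : set (cube n)) : coin_filtration j A ->
  cube_mean (fun w => \1_A w * coin w j) = 0.
Proof.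
move=> FA; apply/eqP; rewrite -[_ == 0](mulrn_eq0 _ 2) /= mulr2n.
rewrite -{1}(cube_mean_flip j) /cube_mean -mulrDr -big_split/= big1 ?mulr0// => w _.
rewrite coin_flip mulrN !indicE.
have -> : (cube_flip j w \in A) = (w \in A).
  apply/idP/idP; rewrite !inE; apply: FA => //; first exact: agree_flip.
  by move=> i ij; rewrite agree_flip.
by rewrite addNr.
Qed.

(** Average the two values of the last coin and use [even_power_two_point]. *)
Lemma walk_moment_rec j (k : nat) :
  cube_mean (fun w => walk j w ^+ (2 * k.+1)) +
    (k.+1 * (2 * k).+1)%:R * cube_mean (fun w => walk j w ^+ (2 * k)) <=
  cube_mean (fun w => walk j.+1 w ^+ (2 * k.+1)).
Proof.
have half : cube_mean (fun w => walk j.+1 w ^+ (2 * k.+1)) =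
    cube_mean (fun w => ((walk j w + 1) ^+ (2 * k.+1) + (walk j w - 1) ^+ (2 * k.+1)) / 2).
  have dbl (z : R) : z = (z + z) / 2 by field.
  rewrite [LHS]dbl -{1}(cube_mean_flip j) /cube_mean -mulrDr -big_split/= -mulrA mulr_suml.
  congr (_ * _); apply: eq_bigr => w _; rewrite !walkS coin_flip.
  rewrite (walk_agree (agree_flip w)) /coin.
  by case: (w j); rewrite /= ?expr1 ?expr0 ?opprK // addrC.
rewrite half /cube_mean mulrCA -mulrDr ler_wpM2l//.
rewrite mulr_sumr -big_split/=; apply: ler_sum => w _.
exact: even_power_two_point.
Qed.

Lemma cube_mean1 : cube_mean (fun _ : cube n => 1) = 1 :> R.
Proof.
by rewrite /cube_mean sumr_const card_ffun card_bool card_ord natrX mulVf//.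
Qed.

Lemma even_walk_ge0 (j k : nat) w : 0 <= walk j w ^+ (2 * k).
Proof. by rewrite mulnC exprM sqr_ge0. Qed.

(** By Pascal's rule, since (2k+2)! = 2 (k+1) (2k+1) (2k)!. *)
Lemma walk_moment_bin (j k : nat) : (j <= n)%N ->
  'C(j, k)%:R * (2 * k)`!%:R <= 2 ^+ k * cube_mean (fun w => walk j w ^+ (2 * k)).
Proof.
have mean0 i : cube_mean (fun w => walk i w ^+ (2 * 0)) = 1.
  by rewrite -cube_mean1; congr cube_mean; apply/funext => w; rewrite muln0 expr0.
elim: j k => [|j IH] [|k] jn.
- by rewrite mean0 bin0 !mulr1.
- rewrite bin0n mul0r mulr_ge0// -[leLHS](mulr0 (2 ^- n)) ler_wpM2l//.
  by apply: sumr_ge0 => w _; exact: even_walk_ge0.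
- by rewrite mean0 bin0 !mulr1.
have := walk_moment_rec (Ordinal jn) k; rewrite /= => rec.
rewrite -(ler_pM2l (_ : 0 < 2 ^+ k.+1)) ?exprn_gt0// in rec.
apply: le_trans rec; rewrite mulrDr binS natrD mulrDl.
rewrite lerD ?IH ?(ltnW jn)//.
have := IH k (ltnW jn).
have k0 : 0 <= (k.+1 * (2 * k).+1)%:R * 2 :> R by [].
move=> /(ler_wpM2l k0); rewrite exprS.
have -> : (2 * k.+1)`!%:R = (k.+1 * (2 * k).+1)%:R * 2 * (2 * k)`!%:R :> R.
  by rewrite mulnS !factS -!natrM; congr (_%:R); lia.
set a := _%:R * 2; set b := _`!%:R.
by rewrite /a; set M := cube_mean _; lra.
Qed.

Lemma walk_even_moment (k : nat) : (2 * k <= n)%N ->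
  ((n * k)%:R / 4) ^+ k <= cube_mean (fun w => walk n w ^+ (2 * k)) :> R.
Proof.
move=> kn; rewrite -(ler_pM2l (_ : 0 < 2 ^+ k)) ?exprn_gt0//.
apply: le_trans (walk_moment_bin k (leqnn n)).
rewrite -natrM; apply: (@le_trans _ _ ((n - k) ^ k * k ^ k)%N%:R); last first.
  by rewrite ler_nat bin_double_fact//; lia.
rewrite -exprMn -expnMn natrX lerXn2r ?nnegrE//.
have : (n * k <= 2 * ((n - k) * k))%N by rewrite mulnA leq_mul//; lia.
rewrite -(ler_nat R) natrM; lra.
Qed.

End random_walk.

(** * The lower rate *)

Section lower_bound.
Context {R : realType} (n : nat) (n0 : (0 < n)%N).
Notation P := (@cube_measure R n).

(** Jensen's inequality for the exponent r, that is monotonicity of the norms. *)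
Lemma cube_lyapunov (g : cube n -> R) (c r : R) : (forall w, 0 <= g w) ->
  0 <= c -> 1 <= r -> c <= cube_mean g -> c `^ r <= cube_mean (fun w => g w `^ r).
Proof.
move=> g0 c0; rewrite le_eqVlt => /predU1P[<-|r1] cg.
  rewrite powRr1//; apply: (le_trans cg); rewrite /cube_mean.
  by under [X in _ <= _ * X]eq_bigr do rewrite powRr1//.
have mg : measurable_fun setT g by [].
have := @integral_powR_jensen R _ _ P setT g c r measurableT mg g0 r1 c0.
rewrite !probability_setT !mule1 !integral_cube => // [|w]; last exact: powR_ge0.
by rewrite !lee_fin; apply.
Qed.

(** Take k to be the smaller of the integer parts of p/2 and n/2: then
    min(p,n)/4 <= k, so that n k / 4 is at least n min(p,n) / 16. This k vanishes when n = 1,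
    where the walk has modulus 1. *)
Lemma walk_powR_moment (p : R) : 2 < p ->
  (Num.sqrt (Num.min p n%:R) * Num.sqrt n%:R / 8) `^ p <=
    cube_mean (fun w : cube n => `|walk n w| `^ p).
Proof.
move=> p2; have p0 : 0 < p by lra.
have n0' : 0 < n%:R :> R by rewrite ltr0n.
have min0 : 0 <= Num.min p n%:R by rewrite le_min (ltW p0) ltW.
suff [x [x0 minx xmean]] : exists x : R,
    [/\ 0 <= x, Num.min p n%:R * n%:R / 64 <= x &
       x `^ (p / 2) <= cube_mean (fun w : cube n => `|walk n w| `^ p)].
  apply: le_trans xmean.
  have s0 : 0 <= Num.sqrt (Num.min p n%:R) * Num.sqrt n%:R / 8 :> R.
    by rewrite !mulr_ge0 ?sqrtr_ge0.
  rewrite -sqr_powR// ge0_ler_powR ?nnegrE ?sqr_ge0//; first by lra.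
  rewrite !exprMn !sqr_sqrtr ?(ltW n0')//; lra.
have [n1|n1] := leqP n 1.
  have {n1} n1 : n = 1%N by lia.
  exists 1; split=> //.
    have : Num.min p n%:R <= n%:R by rewrite ge_min lexx orbT.
    by rewrite n1; lra.
  rewrite powR1 -(cube_mean1 n) /cube_mean ler_wpM2l//; apply: ler_sum => w _.
  have -> : walk n w = walk (Ordinal n0).+1 w :> R by congr (walk _ w).
  by rewrite walkS walk0 add0r normr_sign powR1.
pose k0 := Num.truncn (p / 2).
have /andP[k0p pk0] : k0%:R <= p / 2 < k0.+1%:R by apply: truncn_itv; lra.
have k01 : (1 <= k0)%N.
  have : 1 < k0.+1%:R :> R by lra.
  by rewrite ltr1n.
pose k := minn k0 n./2.
have k1 : (1 <= k)%N by rewrite leq_min k01/=; lia.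
have kn : (2 * k <= n)%N.
  have : (k <= n./2)%N by rewrite geq_minr.
  lia.
have kp : k%:R <= p / 2 :> R by rewrite (le_trans _ k0p)// ler_nat geq_minl.
have kmin : Num.min p n%:R / 4 <= k%:R.
  have [h|h] := leqP k0 n./2.
    rewrite /k (minn_idPl h); have : Num.min p n%:R <= p by rewrite ge_min lexx.
    have : k0.+1%:R <= 2 * k0%:R :> R by rewrite -natrM ler_nat; lia.
    lra.
  rewrite /k (minn_idPr (ltnW h)); have : Num.min p n%:R <= n%:R by rewrite ge_min lexx orbT.
  have : n%:R <= 4 * n./2%:R :> R by rewrite -natrM ler_nat; lia.
  lra.
have k0' : 0 < k%:R :> R by rewrite ltr0n.
have x0 : 0 <= (n * k)%:R / 4 :> R by rewrite divr_ge0.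
exists ((n * k)%:R / 4); split=> //.
  by rewrite natrM; nra.
have r1 : 1 <= p / (2 * k%:R) by rewrite ler_pdivlMr; lra.
have := cube_lyapunov (fun w => even_walk_ge0 n k w) (exprn_ge0 k x0) r1
  (walk_even_moment kn).
rewrite -powR_mulrn// -powRrM.
have -> : k%:R * (p / (2 * k%:R)) = p / 2 by field; lra.
move=> /le_trans; apply; rewrite /cube_mean ler_wpM2l//; apply: ler_sum => w _.
rewrite -(ger0_norm (even_walk_ge0 n k w)) normrX -powR_mulrn// -powRrM natrM.
by rewrite (_ : 2 * k%:R * _ = p)//; field; lra.
Qed.

End lower_bound.

Section walk_martingale.
Context {R : realType} (n : nat).
Notation P := (@cube_measure R n).

Lemma separable_real : separable_space R^o.
Proof.
exists (@ratr R @` setT); last exact: dense_rat.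
exact: sub_countable (card_image_le _ _) _.
Qed.

Lemma smooth2_real : smooth2 R^o 1.
Proof.
move=> x y; rewrite !real_normK ?num_real// expr1n mulr1.
by rewrite le_eqVlt; apply/predU1P; left; ring.
Qed.

Lemma cube_bochner_integrable (g : cube n -> R^o) : bochner_integrable P g.
Proof.
have gs : finitely_valued g by exact: cube_finitely_valued.
split; first exact: finitely_valued_borel.
exists (fun=> g); exact: L1_approx_simple.
Qed.

Lemma cube_simple_integral (A : set (cube n)) (g : cube n -> R^o) :
  simple_integral P A g = cube_mean (fun w => \1_A w * g w).
Proof.
have ids : finitely_valued (fun w : cube n => w) by exact: cube_finitely_valued.
rewrite (simple_integral_comp P g _ ids)// /cube_mean mulr_sumr.
have -> : range (fun w : cube n => w) = setT by apply/seteqP; split=> // w _; exists w.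
rewrite (perm_big (index_enum (cube n)))/=; last first.
  apply: uniq_perm; rewrite ?fset_uniq ?index_enum_uniq// => w.
  by rewrite mem_index_enum in_fset_set ?in_setT//; exact: finite_finset.
apply: eq_bigr => w _; rewrite cube_measureE /cube_mean (bigD1 w)//= big1 ?addr0.
  by rewrite !indicE in_setI (@mem_set _ (_ @^-1` _))// andbT [LHS]/GRing.scale/= mulrA.
move=> v vw; rewrite indicE in_setI [X in _ && X]memNset ?andbF//=.
by move=> /= vw'; rewrite vw' eqxx in vw.
Qed.

Lemma walk_martingale (c : R) :
  martingale0 P (@coin_filtration n) (fun k w => c * walk k w : R^o).
Proof.
have sepR := separable_real.
split=> [|j B _ w w' ww /= |j|j|w].
- exact: coin_filtrationP.
- by rewrite (walk_agree ww).
- exact: cube_bochner_integrable.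
- split; first exact: cube_bochner_integrable.
    by move=> B _ w w' ww /=; rewrite (walk_agree ww).
  move=> A FA.
  rewrite !bochner_integral_simple//; try exact: cube_finitely_valued.
  rewrite !cube_simple_integral.
  have [nj|jn] := leqP n j.
    congr cube_mean; apply/funext => w.
    by rewrite (walk_stop w nj) (walk_stop w (leqW nj)).
  have := cube_mean_coin0 (R := R) (j := Ordinal jn) FA.
  rewrite /cube_mean => coin0; apply/esym.
  transitivity (2 ^- n * \sum_w (\1_A w * (c * walk j w)) +
     c * (2 ^- n * \sum_w \1_A w * coin w (Ordinal jn)) : R).
    rewrite (mulrCA c) -mulrDr; congr (_ * _); rewrite mulr_sumr -big_split/=.
    by apply: eq_bigr => w _; rewrite (walkS (Ordinal jn)) /=; ring.
  by rewrite coin0 mulr0 addr0.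
- by rewrite walk0 mulr0.
Qed.

End walk_martingale.

Section lower_rate.
Context {R : realType} (n : nat) (n0 : (0 < n)%N).
Notation P := (@cube_measure R n).

(** Each increment has modulus c, so S_p is the constant n^(1/p) c. *)
Lemma walk_Lnorm_Sp (c p : R) : 0 <= c -> 0 < p ->
  ('N[P]_p%:E [Sp p (fun k (w : cube n) => (c * walk k w)%R : R^o)] =
    (n%:R `^ p^-1 * c)%:E)%E.
Proof.
move=> c0 p0.
have stop (k : nat) : (n <= k)%N ->
    (fun w : cube n => c * walk k w : R^o) = (fun w => c * walk n w).
  by move=> nk; apply/funext => w; rewrite walk_stop.
have mw k : borel_measurable measurable (fun w : cube n => c * walk k w : R^o).
  exact/finitely_valued_borel/cube_finitely_valued.
rewrite (Lnorm_Sp_stopped P p0 (@separable_real R) mw stop).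
rewrite (eq_bigr (fun=> (c `^ p)%:E)) => [|i _]; last first.
  rewrite (@eq_integral _ _ _ _ _ (cst (c `^ p)%:E)) => [|w _]; last first.
    rewrite walkS -mulrBr addrAC subrr add0r normrM normr_sign mulr1.
    by rewrite ger0_norm.
  by rewrite integral_cst//= [X in (_ * X)%E]cube_measureT mule1.
rewrite sumEFin poweR_EFin sumr_const card_ord -[c `^ p *+ n]mulr_natl.
by rewrite powRM ?powR_ge0// -powRrM divff ?gt_eqF// powRr1.
Qed.

(** The step size c = a n^(-1/p) makes the norm of S_p equal to a. *)
Lemma walk_lower_rate (p a : R) : 2 < p -> 0 < a ->
  ((8^-1 * Num.sqrt (Num.min p n%:R) * n%:R `^ ((p - 2) / (2 * p)) * a)%:E
    <= BCh p a n)%E.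
Proof.
move=> p2 a0; have p0 : 0 < p by lra.
have n0' : 0 < n%:R :> R by rewrite ltr0n.
pose c := a / n%:R `^ p^-1.
have np0 : 0 < n%:R `^ p^-1 :> R by rewrite powR_gt0.
have c0 : 0 < c by rewrite divr_gt0.
apply: (@le_trans _ _ ('N[P]_p%:E [(fun w : cube n => `|(c * walk n w)%R : R^o|%:E)])%E); last first.
  apply: ereal_sup_ubound => /=.
  exists 1, R^o, default_measure_display, (cube n), P, (@coin_filtration n),
    (fun k w => c * walk k w : R^o); split.
  - by split; [|exact: separable_real|exact: smooth2_real].
  - exact: walk_martingale.
  - by move=> k nk; apply/funext => w; rewrite walk_stop.
  - rewrite walk_Lnorm_Sp ?(ltW c0)// mul1e; congr EFin.
    by rewrite /c mulrC divfK ?gt_eqF.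
  - by [].
rewrite LnormE// integral_cube => [|w]; last exact: powR_ge0.
have -> : cube_mean (fun w : cube n => `|(c * walk n w : R^o)| `^ p) =
    c `^ p * cube_mean (fun w : cube n => `|walk n w| `^ p).
  rewrite /cube_mean mulrCA; congr (_ * _); rewrite mulr_sumr.
  by apply: eq_bigr => w _; rewrite normrM powRM// ger0_norm// ltW.
have v0 : 0 <= Num.sqrt (Num.min p n%:R) * Num.sqrt n%:R / 8 :> R.
  by rewrite !mulr_ge0 ?sqrtr_ge0.
have M0 : 0 <= cube_mean (fun w : cube n => `|walk n w| `^ p).
  by rewrite mulr_ge0// sumr_ge0// => w _; rewrite powR_ge0.
rewrite poweR_EFin lee_fin powRM ?powR_ge0//.
have root (x : R) : 0 <= x -> (x `^ p) `^ p^-1 = x.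
  by move=> x0; rewrite -powRrM divff ?gt_eqF// powRr1.
rewrite root ?(ltW c0)//.
have lower := @ge0_ler_powR R p^-1 _ _ _ _ _ (walk_powR_moment n0 p2).
rewrite root// in lower.
apply: le_trans (ler_wpM2l (ltW c0) (lower _ _ _)); first last.
- by rewrite nnegrE.
- by rewrite nnegrE powR_ge0.
- by rewrite invr_ge0 ltW.
have sn : Num.sqrt n%:R = n%:R `^ p^-1 * n%:R `^ ((p - 2) / (2 * p)) :> R.
  rewrite -powR12_sqrt ?(ltW n0')// -powRD ?(gt_eqF n0') ?implybT//.
  by congr (_ `^ _); field; lra.
rewrite sn /c le_eqVlt; apply/predU1P; left; field; exact: lt0r_neq0.
Qed.

End lower_rate.

Unset Implicit Arguments.

Theorem theorem7p1 (R : realType) :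
  exists A : R, 1 <= A /\
    forall (p a : R) (n : nat), 2 < p -> 0 < a -> (0 < n)%N ->
      ((A^-1 * Num.sqrt (Num.min p n%:R) * n%:R `^ ((p - 2) / (2 * p)) * a)%:E
        <= BCh p a n)%E /\
      (BCh p a n
        <= (A * Num.sqrt (Num.min p n%:R) * n%:R `^ ((p - 2) / (2 * p)) * a)%:E)%E.
Proof.
exists 8; split; first by rewrite ler1n.
move=> p a n p2 a0 n0; split; first exact: walk_lower_rate.
apply: ge_ereal_sup => _ [D [X [d [T [P [F [f [[D0 sepX smX] mgf fn Da ->]]]]]]]].
exact: martingale_upper_rate n0 D0 sepX smX mgf fn Da.
Qed.
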